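(* Under the hypotheses of Theorem 6 (in the setting below), let $n=|V|$, let $\psi(\phi)$ denote the sum of the inverse Born series for $\|\phi\|_p<r_p$, and let $M=\sup_{\|\phi\|_p<r_p}\|\psi(\phi)\|_p$ (which is finite). Let $0<\tau<1$ and let $\phi\in\mathbb{C}^{R\times S}$ with $\|\phi\|_p<\tau r_p$. Then for every $N\ge1$, $$\Big\|\psi(\phi)-\sum_{m=1}^N\mathcal K_m(\phi,\dots,\phi)\Big\|_\infty\le M\Big(\frac{1}{1-\tau}\Big)^n\Big(\frac{\|\phi\|_p}{\tau r_p}\Big)^N\frac{1}{1-\frac{\|\phi\|_p}{\tau r_p}}.$$ In particular this bounds $\|\eta-\sum_{m=1}^N\mathcal K_m(\phi,\dots,\phi)\|_\infty$ when $\eta$ is the potential with $\|\eta\|_p<R_*$ whose scattering data is $\phi$.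
   Context: Setting: Let $V$ and $\delta V$ be finite disjoint sets (interior and boundary vertices of a graph), let $R,S\subseteq\delta V$ be nonempty (receivers and sources), let $\alpha_0>0$, and let $G_0$ (the background Green's function) be a complex matrix with rows and columns indexed by $V\cup\delta V$. For $U,W\subseteq V\cup\delta V$, $G_0^{U;W}$ is the submatrix with rows indexed by $U$ and columns by $W$. For $a\in\mathbb{C}^V$, $D_a$ is the diagonal $V\times V$ matrix with diagonal $a$. For $j\ge1$ define the multilinear map $K_j:(\mathbb{C}^V)^j\to\mathbb{C}^{R\times S}$ by $$K_j(\eta_1,\dots,\eta_j)(r,s)=(-1)^{j+1}\alpha_0^{\,j}\,G_0^{r;V}D_{\eta_1}G_0^{V;V}D_{\eta_2}\cdots G_0^{V;V}D_{\eta_j}G_0^{V;s},\qquad r\in R,\ s\in S.$$ Fix $p,q\in[1,\infty]$ with $1/p+1/q=1$; $\|\cdot\|_p$ is the $\ell^p$ norm on $\mathbb{C}^V$ and on $\mathbb{C}^{R\times S}$. Define $\nu_p=\alpha_0\big(\sum_{r\in R}\|G_0^{r;V}\|_{\ell^q(V)}^p\big)^{1/p}\big(\sum_{s\in S}\|G_0^{V;s}\|_{\ell^q(V)}^p\big)^{1/p}$ and $\mu_p=\alpha_0\max_{v\in V}\|G_0^{v;V}\|_{\ell^q(V)}$. Hypotheses of Theorem 6: $|V|=|R\times S|$, $K_1:\mathbb{C}^V\to\mathbb{C}^{R\times S}$ invertible, $\nu_p,\mu_p>0$; $C_p=\min_{\|\eta\|_p=1}\|K_1\eta\|_p$, $r_p=\frac{C_p}{\mu_p}\big[1-2\frac{\nu_p}{C_p}\big(\sqrt{1+C_p/\nu_p}-1\big)\big]$,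 $\lambda_*=1+\sqrt{1+C_p/\nu_p}$, $R_*=C_p/(\mu_p(C_p+\nu_p\lambda_* ))$. Scattering data of $\eta$: $\phi=\sum_{j\ge1}K_j(\eta,\dots,\eta)$. Inverse Born operators: $\mathcal K_1=K_1^{-1}$ and, for $j\ge2$, $$\mathcal K_j(\phi_1,\dots,\phi_j)=-\sum_{m=1}^{j-1}\ \sum_{\substack{i_1+\dots+i_m=j\\ i_l\ge1}}\mathcal K_m\Big(K_{i_1}(\mathcal K_1\phi_1,\dots,\mathcal K_1\phi_{i_1}),\dots,K_{i_m}(\mathcal K_1\phi_{j-i_m+1},\dots,\mathcal K_1\phi_j)\Big);$$ the inverse Born series of $\phi$ is $\sum_{j\ge1}\mathcal K_j(\phi,\dots,\phi)$. By Theorem 6, for $\|\phi\|_p<r_p$ it converges to the unique $\eta$ with $\|\eta\|_p<R_*$ whose scattering data is $\phi$. *)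

(* Defs.v *)
From HB Require Import structures.
From Stdlib Require Import Reals.
From mathcomp Require Import ssreflect ssrfun ssrbool eqtype ssrnat seq choice fintype bigop.
Set Implicit Arguments. Unset Strict Implicit. Unset Printing Implicit Defensive.

Local Open Scope R_scope.

Record CC := mkC { Cre : R; Cim : R }.
Definition C0 : CC := mkC 0 0.
Definition Cadd (a b : CC) : CC := mkC (Cre a + Cre b) (Cim a + Cim b).
Definition Copp (a : CC) : CC := mkC (- Cre a) (- Cim a).
Definition Csub (a b : CC) : CC := Cadd a (Copp b).
Definition Cmul (a b : CC) : CC :=
  mkC (Cre a * Cre b - Cim a * Cim b) (Cre a * Cim b + Cim a * Cre b).
Definition CRscale (x : R) (a : CC) : CC := mkC (x * Cre a) (x * Cim a).
Definition Cmod (a : CC) : R := sqrt (Cre a * Cre a + Cim a * Cim a).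

Definition csum (I : finType) (f : I -> CC) : CC := \big[Cadd/C0]_(i : I) f i.

(* real power with the convention 0^y = 0 (Stdlib's Rpower 0 y = 1) *)
Definition rpow (x y : R) : R := if Req_EM_T x 0 then 0 else Rpower x y.

Inductive ext := PFin of R | PInf.

Definition conjugate (p q : ext) : Prop :=
  match p, q with
  | PFin x, PFin y => 1 <= x /\ 1 <= y /\ / x + / y = 1
  | PFin x, PInf => x = 1
  | PInf, PFin y => y = 1
  | PInf, PInf => False
  end.

Definition lpnormR (I : finType) (p : ext) (f : I -> R) : R :=
  match p with
  | PFin x => rpow (\big[Rplus/0]_(i : I) rpow (Rabs (f i)) x) (/ x)
  | PInf => \big[Rmax/0]_(i : I) Rabs (f i)
  end.

Definition lpnorm (I : finType) (p : ext) (f : I -> CC) : R :=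
  lpnormR p (fun i => Cmod (f i)).

Definition vzero (I : Type) : I -> CC := fun _ => C0.
Definition vadd (I : Type) (f g : I -> CC) : I -> CC := fun i => Cadd (f i) (g i).
Definition vopp (I : Type) (f : I -> CC) : I -> CC := fun i => Copp (f i).
Definition vsub (I : Type) (f g : I -> CC) : I -> CC := fun i => Csub (f i) (g i).
Definition vsum (I : Type) (l : seq (I -> CC)) : I -> CC := foldr (@vadd I) (@vzero I) l.

Definition vconv (I : Type) (u : nat -> I -> CC) (l : I -> CC) : Prop :=
  forall i, Un_cv (fun N => Cmod (Csub (u N i) (l i))) 0.

Fixpoint comps (m j : nat) : seq (seq nat) :=
  match m with
  | 0%N => if j == 0%N then [:: [::]] else [::]
  | m'.+1 => flatten (map (fun i => map (cons i) (comps m' (j - i)%N)) (iota 1 j))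
  end.

Fixpoint blocks (A : Type) (c : seq nat) (l : seq A) : seq (seq A) :=
  match c with
  | [::] => [::]
  | i :: c' => take i l :: blocks c' (drop i l)
  end.

Section Born.
(* Vt = V (interior vertices), Rt = R (receivers), St = S (sources).
   GRV = G_0^{R;V}, GVV = G_0^{V;V}, GVS = G_0^{V;S}. *)
Variables (Vt Rt St : finType) (alpha0 : R)
  (GRV : Rt -> Vt -> CC) (GVV : Vt -> Vt -> CC) (GVS : Vt -> St -> CC).

(* w |-> w G_0^{V;V} D_{eta_2} ... G_0^{V;V} D_{eta_j}  (row vectors) *)
Fixpoint chain (w : Vt -> CC) (etas : seq (Vt -> CC)) : Vt -> CC :=
  match etas with
  | [::] => w
  | eta :: rest =>
      chain (fun v' => Cmul (csum (fun v => Cmul (w v) (GVV v v'))) (eta v')) rest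
  end.

(* K_j(eta_1,...,eta_j), j = size etas (j >= 1; K_0 := 0 is never used) *)
Definition Kop (etas : seq (Vt -> CC)) : Rt * St -> CC :=
  match etas with
  | [::] => fun _ => C0
  | eta1 :: rest => fun rs =>
      CRscale ((-1) ^ (size etas).+1 * alpha0 ^ (size etas))
        (csum (fun v => Cmul (chain (fun v0 => Cmul (GRV rs.1 v0) (eta1 v0)) rest v)
                             (GVS v rs.2)))
  end.

Definition K1 (eta : Vt -> CC) : Rt * St -> CC := Kop [:: eta].

Definition scatPartial (N : nat) (eta : Vt -> CC) : Rt * St -> CC :=
  vsum (map (fun j => Kop (nseq j eta)) (iota 1 N)).

Variable K1inv : (Rt * St -> CC) -> (Vt -> CC).

(* inverse Born operators, with fuel k >= size phis *)
Fixpoint KinvF (k : nat) (phis : seq (Rt * St -> CC)) : Vt -> CC :=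
  match k with
  | 0%N => @vzero Vt
  | k'.+1 =>
      match phis with
      | [:: phi] => K1inv phi
      | _ =>
        vopp (vsum (flatten (map (fun m =>
                 map (fun c => KinvF k' (map (fun b => Kop (map K1inv b)) (blocks c phis)))
                     (comps m (size phis)))
               (iota 1 (size phis).-1))))
      end
  end.

Definition Kinv (phis : seq (Rt * St -> CC)) : Vt -> CC := KinvF (size phis) phis.

Definition invPartial (N : nat) (phi : Rt * St -> CC) : Vt -> CC :=
  vsum (map (fun m => Kinv (nseq m phi)) (iota 1 N)).

Definition nu_p (p q : ext) : R :=
  alpha0 * lpnormR p (fun r => lpnorm q (GRV r))
         * lpnormR p (fun s => lpnorm q (fun v => GVS v s)).

Definition mu_p (q : ext) : R := alpha0 * \big[Rmax/0]_(v : Vt) lpnorm q (GVV v).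

End Born.

Definition r_p (Cp nu mu : R) : R :=
  Cp / mu * (1 - 2 * (nu / Cp) * (sqrt (1 + Cp / nu) - 1)).
Definition lambda_star (Cp nu : R) : R := 1 + sqrt (1 + Cp / nu).
Definition R_star (Cp nu mu : R) : R := Cp / (mu * (Cp + nu * lambda_star Cp nu)).

(* Main.v *)
Require Import Defs.
From HB Require Import structures.
From Stdlib Require Import Reals Lra Lia FunctionalExtensionality.
From mathcomp Require Import ssreflect ssrfun ssrbool eqtype ssrnat seq choice fintype bigop.
From mathcomp Require Import path zify_ssreflect.
Set Implicit Arguments. Unset Strict Implicit. Unset Printing Implicit Defensive.
Local Open Scope R_scope.

(* Write C, nu, mu for the constants and x_j for the j-th term of the inverse series of phi.
   The recursion defining the inverse operators makes the inverse series a formal left inverse of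
   the Born series; regrouping compositions of compositions shows that it is also a formal right
   inverse, i.e. K_1 x_j = - sum_(m >= 2) sum_(i_1 + ... + i_m = j) K_m(x_(i_1), ..., x_(i_m)) for
   j >= 2.  Together with |K_m(eta_1, ..., eta_m)| <= nu mu^(m-1) prod |eta_i| this yields by
   induction |x_1| + ... + |x_N| <= R_star for all N when |phi| < r_p, because R_star is the critical
   point of s |-> s - (nu/C) mu s^2 / (1 - mu s) and r_p / C its critical value.  Hence M <= R_star.
   Cauchy's estimate on the complex line through phi gives |x_m(v)| <= M (|phi| / (tau r_p))^m, and
   a geometric series bounds the tail; (1 - tau)^(-n) >= 1 is only lost.  Finally the partial sums
   of the inverse series solve the Born equation up to O(tau^N), and the nonlinear part of the Born
   series is a strict contraction relative to K_1 between the open and the closed ball of radius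
   R_star, so any eta as in the last claim is their limit. *)

(** * Sums over finite index sets and complex numbers *)

(** Estimating the recursion for the inverse operators term by term would compound the constants at
    every level. The right-inverse identity avoids this: it gives [K_1 x_j] through earlier terms
    only, so [1/C] is paid once per degree and the bounds close up as a scalar fixed-point
    inequality. Passing from left to right inverse is associativity of substitution, which here is a
    statement about cutting compositions into blocks. One number governs both existence and
    uniqueness. With [w = sqrt (1 + C / nu)] one has [1 - mu R_star = 1 / w] and [nu (w^2 - 1) = C]:
    at [R_star] the derivative of the majorant [nu mu s^2 / (1 - mu s)] of the nonlinear part equals
    [C]. This makes [R_star] critical, and also makes [C] the Lipschitz bound of the nonlinear part
    for two vectors of norm [R_star]; one strict inequality of norms then gives a contraction. [M]
    bounds [psi], not its terms. Cauchy's estimate is therefore run on partial sums at roots of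
    unity, without integrals, and needs them close to [psi] uniformly on the circle; this holds
    because rotating [phi] leaves every [|x_m|] unchanged. *)

Lemma RplusA : associative Rplus. Proof. by move=> x y z; rewrite Rplus_assoc. Qed.
Lemma RmultA : associative Rmult. Proof. by move=> x y z; rewrite Rmult_assoc. Qed.
HB.instance Definition _ := Monoid.isComLaw.Build R 0 Rplus RplusA Rplus_comm Rplus_0_l.
HB.instance Definition _ := Monoid.isComLaw.Build R 1 Rmult RmultA Rmult_comm Rmult_1_l.
HB.instance Definition _ := Monoid.isMulLaw.Build R 0 Rmult Rmult_0_l Rmult_0_r.
HB.instance Definition _ :=
  Monoid.isAddLaw.Build R Rmult Rplus
    (fun x y z => Rmult_plus_distr_r x y z) (fun x y z => Rmult_plus_distr_l x y z).

Lemma CC_ext a b : Cre a = Cre b -> Cim a = Cim b -> a = b.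
Proof. by case: a => a1 a2; case: b => b1 b2 /= -> ->. Qed.
Ltac cc := repeat intro; apply: CC_ext; rewrite /=; ring.

Definition Cone : CC := mkC 1 0.
Lemma CaddA : associative Cadd. Proof. by cc. Qed.
Lemma CaddC : commutative Cadd. Proof. by cc. Qed.
Lemma Cadd0 : left_id C0 Cadd. Proof. by cc. Qed.
Lemma CmulA : associative Cmul. Proof. by cc. Qed.
Lemma CmulC : commutative Cmul. Proof. by cc. Qed.
Lemma Cmul1 : left_id Cone Cmul. Proof. by cc. Qed.
Lemma Cmul0l : left_zero C0 Cmul. Proof. by cc. Qed.
Lemma Cmul0r : right_zero C0 Cmul. Proof. by cc. Qed.
Lemma CmulDl : left_distributive Cmul Cadd. Proof. by cc. Qed.
Lemma CmulDr : right_distributive Cmul Cadd. Proof. by cc. Qed.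
HB.instance Definition _ := Monoid.isComLaw.Build CC C0 Cadd CaddA CaddC Cadd0.
HB.instance Definition _ := Monoid.isComLaw.Build CC Cone Cmul CmulA CmulC Cmul1.
HB.instance Definition _ := Monoid.isMulLaw.Build CC C0 Cmul Cmul0l Cmul0r.
HB.instance Definition _ := Monoid.isAddLaw.Build CC Cmul Cadd CmulDl CmulDr.

Lemma Cmod_ge0 a : 0 <= Cmod a.
Proof. exact: sqrt_pos. Qed.

Lemma Cmod_sqr a : Cmod a * Cmod a = Cre a * Cre a + Cim a * Cim a.
Proof. by apply: sqrt_sqrt; nra. Qed.

Lemma Rle_sqr a b : 0 <= b -> a * a <= b * b -> a <= b.
Proof. by move=> hb h; case: (Rle_lt_dec a b) => // hab; nra. Qed.

Lemma Cmod_triangle a b : Cmod (Cadd a b) <= Cmod a + Cmod b.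
Proof.
apply: Rle_sqr; first by have := Cmod_ge0 a; have := Cmod_ge0 b; lra.
have ha := Cmod_ge0 a; have hb := Cmod_ge0 b.
have cs : Cre a * Cre b + Cim a * Cim b <= Cmod a * Cmod b.
  apply: Rle_sqr; first exact: Rmult_le_pos.
  have -> : Cmod a * Cmod b * (Cmod a * Cmod b) = (Cmod a * Cmod a) * (Cmod b * Cmod b) by ring.
  rewrite !Cmod_sqr; have := Rle_0_sqr (Cre a * Cim b - Cim a * Cre b); rewrite /Rsqr; nra.
rewrite Cmod_sqr /=; have := Cmod_sqr a; have := Cmod_sqr b; nra.
Qed.

Lemma Cmod_mul a b : Cmod (Cmul a b) = Cmod a * Cmod b.
Proof. by rewrite /Cmod -sqrt_mult /=; [congr sqrt; ring | nra | nra]. Qed.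

Lemma Cmod_real x : Cmod (mkC x 0) = Rabs x.
Proof. by rewrite /Cmod /= Rmult_0_l Rplus_0_r -[x * x]/(Rsqr x) sqrt_Rsqr_abs. Qed.

Lemma Cmod0 : Cmod C0 = 0.
Proof. by rewrite Cmod_real Rabs_R0. Qed.

Lemma Cmod_opp a : Cmod (Copp a) = Cmod a.
Proof. by rewrite /Cmod /=; congr sqrt; ring. Qed.

Lemma Cmod_eq0 a : Cmod a = 0 -> a = C0.
Proof.
move=> h; have := Cmod_sqr a; rewrite h => e.
by apply: CC_ext => /=; nra.
Qed.

Lemma Cmod_csum (I : Type) (r : seq I) (f : I -> CC) :
  Cmod (\big[Cadd/C0]_(i <- r) f i) <= \big[Rplus/0]_(i <- r) Cmod (f i).
Proof.
apply: (big_ind2 (fun x y => Cmod x <= y)) => [|x1 x2 y1 y2 h1 h2|i _].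
- by rewrite Cmod0; lra.
- by apply: Rle_trans (Cmod_triangle _ _) _; lra.
- lra.
Qed.

Lemma sum_le (I : eqType) (r : seq I) (f g : I -> R) :
  (forall i, i \in r -> f i <= g i) ->
  \big[Rplus/0]_(i <- r) f i <= \big[Rplus/0]_(i <- r) g i.
Proof.
move=> h; rewrite big_seq [X in _ <= X]big_seq.
by apply: (big_ind2 (fun x y => x <= y)) => // *; lra.
Qed.

Lemma sum_ge0 (I : eqType) (r : seq I) (f : I -> R) :
  (forall i, i \in r -> 0 <= f i) -> 0 <= \big[Rplus/0]_(i <- r) f i.
Proof. by move=> h; rewrite big_seq; apply: (big_ind (fun x => 0 <= x)) => // *; lra. Qed.

Lemma sum_ge_term (I : finType) (f : I -> R) j :
  (forall i, 0 <= f i) -> f j <= \big[Rplus/0]_(i : I) f i.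
Proof.
move=> h; rewrite (bigD1 j) //=.
have : 0 <= \big[Rplus/0]_(i | i != j) f i by apply: (big_ind (fun x => 0 <= x)) => // *; lra.
by lra.
Qed.

Lemma max_ge0 (I : finType) (f : I -> R) : 0 <= \big[Rmax/0]_(i : I) f i.
Proof.
rewrite unlock /=; elim: (index_enum I) => [|i l ih] /=; first lra.
exact: Rle_trans ih (Rmax_r _ _).
Qed.

Lemma max_ge_term (I : finType) (f : I -> R) j : f j <= \big[Rmax/0]_(i : I) f i.
Proof.
rewrite unlock /=; have := mem_index_enum j; elim: (index_enum I) => [|i l ih] //=.
rewrite inE => /orP[/eqP <-|/ih h]; first exact: Rmax_l.
exact: Rle_trans h (Rmax_r _ _).
Qed.

Lemma max_le (I : finType) (f : I -> R) A :
  0 <= A -> (forall i, f i <= A) -> \big[Rmax/0]_(i : I) f i <= A.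
Proof.
by move=> hA h; apply: (big_ind (fun x => x <= A)) => // x y hx hy; exact: Rmax_lub.
Qed.

(** * Convexity of the exponential and of real powers *)

Lemma exp_convex l a b : 0 <= l <= 1 ->
  exp (l * a + (1 - l) * b) <= l * exp a + (1 - l) * exp b.
Proof.
move=> hl; set m := l * a + (1 - l) * b.
(* tangent line of exp at the mean m *)
have ta c : exp m * (1 + (c - m)) <= exp c.
  have -> : exp c = exp m * exp (c - m) by rewrite -exp_plus; congr exp; ring.
  apply: Rmult_le_compat_l; [exact/Rlt_le/exp_pos | exact: exp_ineq1_le].
have ha := ta a; have hb := ta b.
have -> : exp m = l * (exp m * (1 + (a - m))) + (1 - l) * (exp m * (1 + (b - m))).
  have -> : 1 + (a - m) = 1 + a - l * a - (1 - l) * b by rewrite /m; ring.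
  have -> : 1 + (b - m) = 1 + b - l * a - (1 - l) * b by rewrite /m; ring.
  by ring.
by apply: Rplus_le_compat; apply: Rmult_le_compat_l => //; lra.
Qed.

Lemma rpow_ge0 x y : 0 <= rpow x y.
Proof. by rewrite /rpow; case: (Req_EM_T _ _) => ? /=; [lra | exact/Rlt_le/exp_pos]. Qed.

Lemma rpow0 y : rpow 0 y = 0.
Proof. by rewrite /rpow; case: (Req_EM_T _ _). Qed.

Lemma rpow_pos x y : 0 < x -> rpow x y = Rpower x y.
Proof. by move=> h; rewrite /rpow; case: (Req_EM_T _ _) => ? /= //; lra. Qed.

Lemma rpow_gt0 x y : 0 < x -> 0 < rpow x y.
Proof. by move=> h; rewrite rpow_pos //; exact: exp_pos. Qed.

Lemma rpow_le x y a : 0 <= x <= y -> 0 <= a -> rpow x a <= rpow y a.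
Proof.
move=> [hx hxy] ha; case: (Req_dec x 0) => [->|hx0]; first by rewrite rpow0; exact: rpow_ge0.
by rewrite !rpow_pos; [apply: Rle_Rpower_l; lra | lra | lra].
Qed.

Lemma rpow_mul x y a : 0 <= x -> 0 <= y -> rpow (x * y) a = rpow x a * rpow y a.
Proof.
move=> hx hy; case: (Req_dec x 0) => [->|hx0]; first by rewrite Rmult_0_l rpow0; ring.
case: (Req_dec y 0) => [->|hy0]; first by rewrite Rmult_0_r rpow0; ring.
by rewrite !rpow_pos; [rewrite Rpower_mult_distr //; lra | nra..].
Qed.

Lemma rpowK x a b : 0 <= x -> a * b = 1 -> rpow (rpow x a) b = x.
Proof.
move=> hx hab; case: (Req_dec x 0) => [->|hx0]; first by rewrite !rpow0.
have h : 0 < x by lra.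
by rewrite (rpow_pos a h) rpow_pos ?Rpower_mult ?hab ?Rpower_1 //; exact: exp_pos.
Qed.

(** Convexity of [exp] at the points [x ln a] and [y ln b] with weights [/ x] and [/ y]; zero
    arguments, where [ln] says nothing, are settled first. *)
Lemma young a b x y : 0 <= a -> 0 <= b -> 1 <= x -> 1 <= y -> / x + / y = 1 ->
  a * b <= / x * rpow a x + / y * rpow b y.
Proof.
move=> ha hb hx hy hxy.
have ix : 0 < / x by apply: Rinv_0_lt_compat; lra.
have iy : 0 < / y by apply: Rinv_0_lt_compat; lra.
have := rpow_ge0 a x; have := rpow_ge0 b y => hB hA.
case: (Req_dec a 0) => [->|ha0]; first by rewrite rpow0; nra.
case: (Req_dec b 0) => [->|hb0]; first by rewrite rpow0; nra.
rewrite !rpow_pos /Rpower; [|lra..].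
have -> : / y = 1 - / x by lra.
have e : a * b = exp (/ x * (x * ln a) + (1 - / x) * (y * ln b)).
  have -> : 1 - / x = / y by lra.
  rewrite exp_plus -!Rmult_assoc !Rinv_l ?Rmult_1_l; [|lra..].
  by rewrite !exp_ln; [|lra..].
by rewrite e; apply: exp_convex; lra.
Qed.

(** Convexity of [exp] between [x ln s] and [0] with weight [/ x] on the first, multiplied by
    [x]. *)
Lemma rpow_bernoulli s x : 0 <= s -> 1 <= x -> 1 + x * (s - 1) <= rpow s x.
Proof.
move=> hs hx; case: (Req_dec s 0) => [->|hs0]; first by rewrite rpow0; lra.
have ix : 0 < / x by apply: Rinv_0_lt_compat; lra.
have ix1 : / x <= 1 by rewrite -Rinv_1; apply: Rinv_le_contravar; lra.
have := @exp_convex (/ x) (x * ln s) 0; rewrite rpow_pos /Rpower; last lra.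
rewrite Rmult_0_r Rplus_0_r -Rmult_assoc Rinv_l ?Rmult_1_l; last lra.
rewrite exp_ln; last lra.
rewrite exp_0 => h; have {}h := h ltac:(lra).
have := Rmult_le_compat_l x _ _ ltac:(lra) h.
have -> : x * (/ x * exp (x * ln s) + (1 - / x) * 1) = exp (x * ln s) + x - 1.
  by field; lra.
lra.
Qed.

(** A power lies above its tangent at the mean [m]: by homogeneity this is Bernoulli's inequality at
    [c / m]. Averaging the tangent bounds at [a] and [b] cancels the linear terms. *)
Lemma rpow_convex l a b x : 0 <= l <= 1 -> 0 <= a -> 0 <= b -> 1 <= x ->
  rpow (l * a + (1 - l) * b) x <= l * rpow a x + (1 - l) * rpow b x.
Proof.
move=> hl ha hb hx; set m := l * a + _.
have hm : 0 <= m by rewrite /m; nra.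
have := rpow_ge0 a x; have := rpow_ge0 b x => hB hA.
case: (Req_dec m 0) => [->|hm0]; first by rewrite rpow0; nra.
have hmp : 0 < m by lra.
have tang c : 0 <= c -> rpow m x * (1 + x * (c / m - 1)) <= rpow c x.
  move=> hc; have e : c = m * (c / m) by field.
  have hq : 0 <= c / m by apply: Rmult_le_pos => //; apply/Rlt_le/Rinv_0_lt_compat.
  rewrite {2}e rpow_mul //; apply: Rmult_le_compat_l; first exact: rpow_ge0.
  exact: rpow_bernoulli.
have := tang a ha; have := tang b hb => h1 h2.
have e : rpow m x = l * (rpow m x * (1 + x * (a / m - 1)))
                  + (1 - l) * (rpow m x * (1 + x * (b / m - 1))).
  have : l * (a / m) + (1 - l) * (b / m) = 1.
    have -> : l * (a / m) + (1 - l) * (b / m) = m / m by rewrite {3}/m; field.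
    by field.
  move=> h; have -> : l * (rpow m x * (1 + x * (a / m - 1)))
                  + (1 - l) * (rpow m x * (1 + x * (b / m - 1)))
      = rpow m x * (1 + x * (l * (a / m) + (1 - l) * (b / m) - 1)) by ring.
  by rewrite h; ring.
by rewrite e; apply: Rplus_le_compat; apply: Rmult_le_compat_l => //; lra.
Qed.

(** * The l^p norms *)

Definition ext_ge1 (p : ext) : Prop := if p is PFin x then 1 <= x else True.

Lemma conjugate_ge1 p q : conjugate p q -> ext_ge1 p /\ ext_ge1 q.
Proof. by case: p => [x|]; case: q => [y|] //= h; split => //; lra. Qed.

Section LpNorm.
Variable (I : finType).
Implicit Types (f g : I -> R) (p q : ext).

Definition powsum x f := \big[Rplus/0]_(i : I) rpow (Rabs (f i)) x.

Lemma powsum_ge0 x f : 0 <= powsum x f.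
Proof. by apply: sum_ge0 => i _; exact: rpow_ge0. Qed.

Lemma lpnormR_ge0 p f : 0 <= lpnormR p f.
Proof. by case: p => [x|]; [exact: rpow_ge0 | exact: max_ge0]. Qed.

Lemma rpow_lpnormR x f : 1 <= x -> rpow (lpnormR (PFin x) f) x = powsum x f.
Proof. by move=> hx; apply: rpowK; [exact: powsum_ge0 | field; lra]. Qed.

Lemma lpnormR_le x f A : 1 <= x -> 0 <= A -> powsum x f <= rpow A x -> lpnormR (PFin x) f <= A.
Proof.
move=> hx hA h; rewrite -[A](@rpowK _ x (/ x)) //; last by field; lra.
apply: rpow_le; first by split => //; exact: powsum_ge0.
by apply/Rlt_le/Rinv_0_lt_compat; lra.
Qed.

Lemma lpnormR_ge_term p f i : ext_ge1 p -> Rabs (f i) <= lpnormR p f.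
Proof.
case: p => [x|] /= hx; last exact: (max_ge_term (fun i => Rabs (f i))).
rewrite -[Rabs (f i)](@rpowK _ x (/ x)); [|exact: Rabs_pos | by field; lra].
apply: rpow_le; last by apply/Rlt_le/Rinv_0_lt_compat; lra.
split; first exact: rpow_ge0.
by apply: (@sum_ge_term _ (fun i => rpow (Rabs (f i)) x)) => j; exact: rpow_ge0.
Qed.

Lemma lpnormR_mono p f g : ext_ge1 p -> (forall i, Rabs (f i) <= g i) ->
  lpnormR p f <= lpnormR p g.
Proof.
move=> hp h; have h' i : Rabs (f i) <= Rabs (g i).
  by apply: Rle_trans (h i) _; exact: Rle_abs.
case: p hp => [x|] /= hx.
  apply: rpow_le; last by apply/Rlt_le/Rinv_0_lt_compat; lra.
  split; first exact: powsum_ge0.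
  apply: sum_le => i _; apply: rpow_le; last lra.
  by split => //; exact: Rabs_pos.
by apply: max_le => [|i]; [exact: max_ge0 | apply: Rle_trans (h' i) _; exact: (max_ge_term (fun i => Rabs (g i)))].
Qed.

Lemma lpnormR_scale_le p c f : ext_ge1 p -> lpnormR p (fun i => c * f i) <= Rabs c * lpnormR p f.
Proof.
have hc := Rabs_pos c.
case: p => [x|] hx.
  apply: lpnormR_le => //; first by apply: Rmult_le_pos => //; exact: lpnormR_ge0.
  rewrite rpow_mul //; last exact: lpnormR_ge0.
  rewrite (rpow_lpnormR f hx) /powsum big_distrr /=; apply: sum_le => i _.
  by rewrite Rabs_mult rpow_mul //; [lra | exact: Rabs_pos].
apply: max_le => [|i]; first by apply: Rmult_le_pos => //; exact: max_ge0.
by rewrite Rabs_mult; apply: Rmult_le_compat_l => //; exact: (max_ge_term (fun i => Rabs (f i))).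
Qed.

Lemma lpnormR_eq0 p f : ext_ge1 p -> lpnormR p f = 0 -> forall i, f i = 0.
Proof.
move=> hp h i; have := lpnormR_ge_term f i hp; rewrite h.
by have := Rabs_pos (f i); case: (Req_dec (f i) 0) => // /Rabs_no_R0; lra.
Qed.

Lemma powsum_normalized x f : 1 <= x -> 0 < lpnormR (PFin x) f -> (forall i, 0 <= f i) ->
  \big[Rplus/0]_(i : I) rpow (f i / lpnormR (PFin x) f) x <= 1.
Proof.
set A := lpnormR _ f => hx A0 hf; apply: (Rmult_le_reg_l (rpow A x)); first exact: rpow_gt0.
rewrite Rmult_1_r [X in _ <= X](rpow_lpnormR f hx) /powsum big_distrr /=; apply: sum_le => i _.
rewrite -rpow_mul; [|lra|]; last first.
  by apply: Rmult_le_pos; [exact: hf | apply/Rlt_le/Rinv_0_lt_compat; lra].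
rewrite Rabs_pos_eq //; have -> : A * (f i / A) = f i by field; lra.
lra.
Qed.

(** For norms [A], [B] the quotient [(f + g) / (A + B)] is the convex combination of [f / A] and
    [g / B] with weights [A / (A + B)] and [B / (A + B)], so convexity of the power suffices.
    Vanishing norms cannot be divided by and are treated first. *)
Lemma lpnormR_triangle p f g : ext_ge1 p -> (forall i, 0 <= f i) -> (forall i, 0 <= g i) ->
  lpnormR p (fun i => f i + g i) <= lpnormR p f + lpnormR p g.
Proof.
move=> hp hf hg; have := lpnormR_ge0 p f; have := lpnormR_ge0 p g => hB hA.
case: (Req_dec (lpnormR p f) 0) => [A0|A0].
  have f0 := lpnormR_eq0 hp A0; rewrite A0 Rplus_0_l; apply: lpnormR_mono => // i.
  by rewrite f0 Rplus_0_l Rabs_pos_eq; [lra | exact: hg].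
case: (Req_dec (lpnormR p g) 0) => [B0|B0].
  have g0 := lpnormR_eq0 hp B0; rewrite B0 Rplus_0_r; apply: lpnormR_mono => // i.
  by rewrite g0 Rplus_0_r Rabs_pos_eq; [lra | exact: hf].
case: p hp hA hB A0 B0 => [x|] hx; last first.
  move=> *; apply: max_le => [|i]; first lra.
  rewrite Rabs_pos_eq; last by apply: Rplus_le_le_0_compat.
  have /= := lpnormR_ge_term f i hx; have /= := lpnormR_ge_term g i hx.
  by rewrite !Rabs_pos_eq //; lra.
set A := lpnormR _ f; set B := lpnormR _ g => hA hB A0 B0.
have hAB : 0 < A + B by lra.
have hl : 0 <= A / (A + B) <= 1.
  have h : A / (A + B) * (A + B) = A by field; lra.
  by split; apply: (Rmult_le_reg_r (A + B)); rewrite ?h; lra.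
apply: lpnormR_le => //; first lra.
have e : 1 - A / (A + B) = B / (A + B) by field; lra.
have step i : rpow (Rabs (f i + g i)) x <=
    rpow (A + B) x * (A / (A + B) * rpow (f i / A) x + (1 - A / (A + B)) * rpow (g i / B) x).
  have hfA : 0 <= f i / A.
    by apply: Rmult_le_pos; [exact: hf | apply/Rlt_le/Rinv_0_lt_compat; lra].
  have hgB : 0 <= g i / B.
    by apply: Rmult_le_pos; [exact: hg | apply/Rlt_le/Rinv_0_lt_compat; lra].
  have -> : Rabs (f i + g i) = (A + B) * (A / (A + B) * (f i / A) + (1 - A / (A + B)) * (g i / B)).
    rewrite Rabs_pos_eq; last by apply: Rplus_le_le_0_compat.
    by rewrite e; field; lra.
  rewrite rpow_mul; [|lra|nra].
  by apply: Rmult_le_compat_l; [exact: rpow_ge0 | exact: rpow_convex].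
apply: Rle_trans (sum_le (fun i _ => step i)) _.
rewrite -big_distrr big_split /= -!big_distrr /=.
have h1 := powsum_normalized hx (ltac:(lra) : 0 < A) hf.
have h2 := powsum_normalized hx (ltac:(lra) : 0 < B) hg.
rewrite -/A in h1; rewrite -/B in h2.
rewrite -[X in _ <= X]Rmult_1_r; apply: Rmult_le_compat_l; first exact: rpow_ge0.
by nra.
Qed.

Lemma sup_le_lpnormR p f : ext_ge1 p -> lpnormR PInf f <= lpnormR p f.
Proof.
by move=> hp; apply: max_le => [|i]; [exact: lpnormR_ge0 | exact: lpnormR_ge_term].
Qed.

Lemma lpnormR_le_sum p f : ext_ge1 p -> lpnormR p f <= \big[Rplus/0]_(i : I) Rabs (f i).
Proof.
have hS i : Rabs (f i) <= \big[Rplus/0]_(i : I) Rabs (f i).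
  by apply: (@sum_ge_term _ (fun i => Rabs (f i))) => j; exact: Rabs_pos.
case: p => [x|] hx; last by apply: max_le => // ; apply: sum_ge0 => i _; exact: Rabs_pos.
move: hS; set S := \big[Rplus/0]_(i : I) _ => hS.
have S0 : 0 <= S by apply: sum_ge0 => i _; exact: Rabs_pos.
case: (Req_dec S 0) => [e|Sn0].
  apply: lpnormR_le => //; rewrite e rpow0 /powsum big1; first lra.
  move=> i _; have -> : Rabs (f i) = 0; last exact: rpow0.
  by have := hS i; rewrite e; have := Rabs_pos (f i); lra.
apply: lpnormR_le => //.
(* After division by [S] this is [t^x <= t] on [[0, 1]], that is, convexity between [1] and [0]. *)
have hc i : rpow (Rabs (f i)) x <= rpow S x * (Rabs (f i) / S).
  have e : Rabs (f i) = S * (Rabs (f i) / S) by field.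
  have hq : 0 <= Rabs (f i) / S <= 1.
    have h : Rabs (f i) / S * S = Rabs (f i) by field.
    by split; apply: (Rmult_le_reg_r S); rewrite ?h; have := Rabs_pos (f i); have := hS i; lra.
  rewrite {1}e rpow_mul //; last lra.
  apply: Rmult_le_compat_l; first exact: rpow_ge0.
  have := @rpow_convex _ 1 0 x hq ltac:(lra) ltac:(lra) hx.
  rewrite rpow0 !Rmult_0_r Rmult_1_r !Rplus_0_r (rpow_pos _ Rlt_0_1) /Rpower ln_1 Rmult_0_r exp_0.
  lra.
apply: Rle_trans (sum_le (fun i _ => hc i)) _.
rewrite -big_distrr /= /Rdiv -big_distrl /= -/S Rinv_r //; lra.
Qed.

Lemma sum_le_max_mul f g : (forall i, 0 <= f i) -> (forall i, 0 <= g i) ->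
  \big[Rplus/0]_(i : I) (f i * g i) <= \big[Rplus/0]_(i : I) f i * \big[Rmax/0]_(i : I) g i.
Proof.
move=> hf hg; rewrite big_distrl /=; apply: sum_le => i _.
by apply: Rmult_le_compat_l => //; exact: max_ge_term.
Qed.

Lemma lpnormR_1 f : (forall i, 0 <= f i) -> lpnormR (PFin 1) f = \big[Rplus/0]_(i : I) f i.
Proof.
move=> hf; rewrite /lpnormR Rinv_1.
have r1 x : 0 <= x -> rpow x 1 = x.
  by move=> hx; rewrite -[RHS](@rpowK _ 1 1) // ?rpowK //; try lra;
     case: (Req_dec x 0) => [->|x0]; rewrite ?rpow0 // !rpow_pos ?Rpower_1; lra.
rewrite r1; first by apply: eq_bigr => i _; rewrite Rabs_pos_eq // r1.
by apply: sum_ge0 => i _; exact: rpow_ge0.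
Qed.

Lemma lpnormR_inf f : (forall i, 0 <= f i) -> lpnormR PInf f = \big[Rmax/0]_(i : I) f i.
Proof. by move=> hf; apply: eq_bigr => i _; rewrite Rabs_pos_eq. Qed.

(** Young's inequality for the normalized functions, summed; the two endpoint pairs are sum times
    maximum. *)
Lemma holder p q f g : conjugate p q -> (forall i, 0 <= f i) -> (forall i, 0 <= g i) ->
  \big[Rplus/0]_(i : I) (f i * g i) <= lpnormR p f * lpnormR q g.
Proof.
move=> pq hf hg; case: p q pq => [x|] [y|] // pq; last 2 first.
- by rewrite (pq : x = 1) lpnormR_1 // lpnormR_inf //; exact: sum_le_max_mul.
- rewrite (pq : y = 1) lpnormR_1 // lpnormR_inf // Rmult_comm.
  by under eq_bigr do rewrite Rmult_comm; exact: sum_le_max_mul.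
case: pq => hx [hy hxy].
have := lpnormR_ge0 (PFin x) f; have := lpnormR_ge0 (PFin y) g.
case: (Req_dec (lpnormR (PFin x) f) 0) => [A0|A0].
  have f0 := lpnormR_eq0 (p := PFin x) hx A0; rewrite big1 => [|i _]; last by rewrite f0 Rmult_0_l.
  by move=> *; exact: Rmult_le_pos.
case: (Req_dec (lpnormR (PFin y) g) 0) => [B0|B0].
  have g0 := lpnormR_eq0 (p := PFin y) hy B0; rewrite big1 => [|i _]; last by rewrite g0 Rmult_0_r.
  by move=> *; exact: Rmult_le_pos.
move: A0 B0; set A := lpnormR _ f; set B := lpnormR _ g => A0 B0 hB hA.
have h1 := powsum_normalized hx (ltac:(lra) : 0 < A) hf.
have h2 := powsum_normalized hy (ltac:(lra) : 0 < B) hg.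
rewrite -/A in h1; rewrite -/B in h2.
have step i : f i * g i <= A * B * (/ x * rpow (f i / A) x + / y * rpow (g i / B) y).
  have hfA : 0 <= f i / A.
    by apply: Rmult_le_pos; [exact: hf | apply/Rlt_le/Rinv_0_lt_compat; lra].
  have hgB : 0 <= g i / B.
    by apply: Rmult_le_pos; [exact: hg | apply/Rlt_le/Rinv_0_lt_compat; lra].
  have -> : f i * g i = A * B * ((f i / A) * (g i / B)) by field; lra.
  by apply: Rmult_le_compat_l; [nra | exact: young].
apply: Rle_trans (sum_le (fun i _ => step i)) _.
rewrite -big_distrr big_split /= -!big_distrr /=.
rewrite -[X in _ <= X]Rmult_1_r; apply: Rmult_le_compat_l; first nra.
have ix : 0 < / x by apply: Rinv_0_lt_compat; lra.
have iy : 0 < / y by apply: Rinv_0_lt_compat; lra.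
by nra.
Qed.

End LpNorm.

(** A double sum of powers factors. This produces the product of a receiver norm and a source norm
    in [nu_p]. *)
Lemma lpnormR_tensor (I J : finType) p (f : I -> R) (g : J -> R) : ext_ge1 p ->
  (forall i, 0 <= f i) -> (forall j, 0 <= g j) ->
  lpnormR p (fun ij : I * J => f ij.1 * g ij.2) <= lpnormR p f * lpnormR p g.
Proof.
move=> hp hf hg; have hfn := lpnormR_ge0 p f; have hgn := lpnormR_ge0 p g.
case: p hp hfn hgn => [x|] hx hfn hgn.
  apply: lpnormR_le => //; first exact: Rmult_le_pos.
  rewrite rpow_mul // (rpow_lpnormR f hx) (rpow_lpnormR g hx) /powsum big_distrl /=.
  under [X in _ <= X]eq_bigr do rewrite big_distrr /=.
  rewrite pair_bigA /=; apply: sum_le => ij _.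
  by rewrite Rabs_mult rpow_mul; [lra | exact: Rabs_pos..].
apply: max_le => [|ij]; first exact: Rmult_le_pos.
by rewrite Rabs_mult; apply: Rmult_le_compat;
   [exact: Rabs_pos | exact: Rabs_pos | exact: lpnormR_ge_term | exact: lpnormR_ge_term].
Qed.

Section LpNormC.
Variable (I : finType) (p : ext).
Hypothesis hp : ext_ge1 p.
Implicit Types f g : I -> CC.

Definition vscale (J : Type) (a : CC) (f : J -> CC) : J -> CC := fun i => Cmul a (f i).

Lemma lpnorm_ge0 f : 0 <= lpnorm p f.
Proof. exact: lpnormR_ge0. Qed.

Lemma lpnorm_ge_term f i : Cmod (f i) <= lpnorm p f.
Proof.
by rewrite -[Cmod _]Rabs_pos_eq; [exact: (lpnormR_ge_term (fun i => Cmod (f i))) | exact: Cmod_ge0].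
Qed.

Lemma lpnorm_triangle f g : lpnorm p (vadd f g) <= lpnorm p f + lpnorm p g.
Proof.
apply: Rle_trans (lpnormR_triangle hp _ _) => [|i|i]; try exact: Cmod_ge0.
apply: lpnormR_mono => // i; rewrite Rabs_pos_eq; [exact: Cmod_triangle | exact: Cmod_ge0].
Qed.

Lemma lpnorm_scale_le a f : lpnorm p (vscale a f) <= Cmod a * lpnorm p f.
Proof.
rewrite -[Cmod a]Rabs_pos_eq; last exact: Cmod_ge0.
apply: Rle_trans (lpnormR_scale_le _ _ hp); apply: lpnormR_mono => // i.
by rewrite /vscale Cmod_mul Rabs_pos_eq; [lra | apply: Rmult_le_pos; exact: Cmod_ge0].
Qed.

Lemma lpnorm_zero : lpnorm p (@vzero I) = 0.
Proof.
apply: Rle_antisym; last exact: lpnorm_ge0.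
apply: Rle_trans (lpnormR_le_sum _ hp) _.
by rewrite big1 => [|i _]; [lra | rewrite Cmod0 Rabs_R0].
Qed.

Lemma lpnorm_opp f : lpnorm p (vopp f) = lpnorm p f.
Proof.
by congr (lpnormR p); apply: functional_extensionality => i; rewrite /vopp Cmod_opp.
Qed.

Lemma lpnorm_eq0 f : lpnorm p f = 0 -> f = @vzero I.
Proof.
move=> h; apply: functional_extensionality => i; apply: Cmod_eq0.
exact: (lpnormR_eq0 hp h).
Qed.

Lemma lpnorm_scale a f : lpnorm p (vscale a f) = Cmod a * lpnorm p f.
Proof.
apply: Rle_antisym; first exact: lpnorm_scale_le.
have ha := Cmod_ge0 a; have h0 := lpnorm_ge0 (vscale a f).
case: (Req_dec (Cmod a) 0) => [->|a0]; first lra.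
(* The reverse inequality is the upper bound for scaling back by the complex inverse [b] of [a]. *)
pose n := Cmod a * Cmod a.
pose b := mkC (Cre a / n) (- Cim a / n).
have hn : n <> 0 by rewrite /n; nra.
have hab : Cmul b a = Cone.
  have e : n = Cre a * Cre a + Cim a * Cim a by rewrite /n Cmod_sqr.
  by apply: CC_ext => /=; [rewrite -[1](Rinv_r n) // {3}e; field | field].
have e : f = vscale b (vscale a f).
  by apply: functional_extensionality => i; rewrite /vscale CmulA hab Cmul1.
have := lpnorm_scale_le b (vscale a f); rewrite -e => h.
have hb : Cmod a * Cmod b = 1 by rewrite Rmult_comm -Cmod_mul hab Cmod_real Rabs_R1.
have := Rmult_le_compat_l _ _ _ ha h; rewrite -Rmult_assoc hb; lra.
Qed.

Lemma lpnorm_le_sum f : lpnorm p f <= \big[Rplus/0]_(i : I) Cmod (f i).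
Proof.
apply: Rle_trans (lpnormR_le_sum _ hp) _; apply: sum_le => i _.
by rewrite Rabs_pos_eq; [lra | exact: Cmod_ge0].
Qed.

End LpNormC.

Section VectorSum.
Variable (I : Type).

Lemma vaddA : associative (@vadd I).
Proof. by move=> f g h; apply: functional_extensionality => i; exact: CaddA. Qed.
Lemma vaddC : commutative (@vadd I).
Proof. by move=> f g; apply: functional_extensionality => i; exact: CaddC. Qed.
Lemma vadd0 : left_id (@vzero I) (@vadd I).
Proof. by move=> f; apply: functional_extensionality => i; exact: Cadd0. Qed.
HB.instance Definition _ := Monoid.isComLaw.Build (I -> CC) (@vzero I) (@vadd I) vaddA vaddC vadd0.

Lemma vsum_big (l : seq (I -> CC)) : vsum l = \big[@vadd I/@vzero I]_(f <- l) f.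
Proof. by elim: l => [|f l ih]; rewrite ?big_nil // big_cons -ih. Qed.

Lemma big_vadd_at (T : Type) (r : seq T) (F : T -> I -> CC) i :
  (\big[@vadd I/@vzero I]_(t <- r) F t) i = \big[Cadd/C0]_(t <- r) F t i.
Proof. by apply: (big_morph (fun f : I -> CC => f i)). Qed.

End VectorSum.

Notation "\vsum_ ( i <- r ) F" := (\big[@vadd _/@vzero _]_(i <- r) F)
  (at level 36, F at level 36, i, r at level 50).

Lemma lpnorm_sum (I : finType) p (T : eqType) (r : seq T) (F : T -> I -> CC) : ext_ge1 p ->
  lpnorm p (\vsum_(t <- r) F t) <= \big[Rplus/0]_(t <- r) lpnorm p (F t).
Proof.
move=> hp; apply: (big_ind2 (fun x y => lpnorm p x <= y)) => [|x1 x2 y1 y2 h1 h2|i _].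
- by rewrite lpnorm_zero //; lra.
- by apply: Rle_trans (lpnorm_triangle hp _ _) _; lra.
- lra.
Qed.

(** * Maps that are linear in each entry of a list *)

Section Multilinear.
Variables (I J : Type).

Definition linear (f : (I -> CC) -> J -> CC) :=
  forall a x y, f (vadd (vscale a x) y) = vadd (vscale a (f x)) (f y).

(** Lists of every length are covered at once, because the Born and inverse Born operators of all
    orders are single functions of a list. *)
Definition multilinear (f : seq (I -> CC) -> J -> CC) :=
  forall l1 l2, linear (fun x => f (l1 ++ x :: l2)).

Variable f : (I -> CC) -> J -> CC.
Hypothesis lf : linear f.

Lemma linear0 : f (@vzero I) = @vzero J.
Proof.
have -> : @vzero I = vadd (vscale (Copp Cone) (@vzero I)) (@vzero I).
  by apply: functional_extensionality => i; cc.
by rewrite lf; apply: functional_extensionality => i; cc.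
Qed.

Lemma linearZ a x : f (vscale a x) = vscale a (f x).
Proof.
have -> : vscale a x = vadd (vscale a x) (@vzero I).
  by apply: functional_extensionality => i; cc.
by rewrite lf linear0; apply: functional_extensionality => i; cc.
Qed.

Lemma linearD x y : f (vadd x y) = vadd (f x) (f y).
Proof.
have {1}-> : x = vscale Cone x by apply: functional_extensionality => i; cc.
by rewrite lf; apply: functional_extensionality => i; cc.
Qed.

Lemma linear_sum (T : Type) (r : seq T) (F : T -> I -> CC) :
  f (\vsum_(t <- r) F t) = \vsum_(t <- r) f (F t).
Proof. by apply: big_morph; [exact: linearD | exact: linear0]. Qed.

End Multilinear.

(** Homogeneity of degree [m], with [iter] playing the power [a^m]. The prefix [l] collects the
    slots already freed of the scalar. *)
Lemma multilinear_nseqZ (I J : Type) (f : seq (I -> CC) -> J -> CC) a x m : multilinear f ->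
  forall l, f (l ++ nseq m (vscale a x)) = vscale (iter m (Cmul a) Cone) (f (l ++ nseq m x)).
Proof.
move=> lf; elim: m => [|m ih] l /=; first by apply: functional_extensionality => i; cc.
rewrite (linearZ (lf l _)) -cat_rcons ih cat_rcons.
by apply: functional_extensionality => i; cc.
Qed.

Lemma multilinear_zero (I J : eqType) (f : seq (I -> CC) -> J -> CC) (T : eqType) (y : T -> I -> CC) c t :
  multilinear f -> t \in c -> y t = @vzero I -> f (map y c) = @vzero J.
Proof.
move=> lf /splitPr[c1 c2] yt; rewrite map_cat /= yt; exact: (linear0 (lf _ _)).
Qed.

(** * Multilinearity and norm bound of the Born operators *)

Section KopLinear.
Variables (Vt Rt St : finType) (alpha0 : R)
  (GRV : Rt -> Vt -> CC) (GVV : Vt -> Vt -> CC) (GVS : Vt -> St -> CC).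

Let step (w eta : Vt -> CC) : Vt -> CC :=
  fun v' => Cmul (csum (fun v => Cmul (w v) (GVV v v'))) (eta v').

Lemma csum_linear (T : finType) a (f g : T -> CC) :
  csum (fun v => Cadd (Cmul a (f v)) (g v)) = Cadd (Cmul a (csum f)) (csum g).
Proof. by rewrite /csum big_split /= big_distrr. Qed.

(** [chain] absorbs each potential into its row vector, so linearity in a potential reduces to
    linearity in the weight. *)
Lemma chain_linear_weight etas : linear (fun w => chain GVV w etas).
Proof.
elim: etas => [|eta etas ih] a x y //=.
rewrite -ih; congr chain; apply: functional_extensionality => v'; rewrite /vadd /vscale.
rewrite CmulA -CmulDl -csum_linear; congr (Cmul (csum _) _).
by apply: functional_extensionality => v; cc.
Qed.

Lemma chain_multilinear w : multilinear (chain GVV w).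
Proof.
move=> l1 l2; elim: l1 w => [|eta l1 ih] w a x y /=; last exact: ih.
rewrite -chain_linear_weight; congr chain; apply: functional_extensionality => v'.
by rewrite /vadd /vscale; cc.
Qed.

Lemma Kop_cons eta etas rs : Kop alpha0 GRV GVV GVS (eta :: etas) rs =
  Cmul (mkC ((-1) ^ (size etas).+2 * alpha0 ^ (size etas).+1) 0)
    (csum (fun v => Cmul (chain GVV (fun v0 => Cmul (GRV rs.1 v0) (eta v0)) etas v) (GVS v rs.2))).
Proof. by cc. Qed.

Lemma Kop_multilinear : multilinear (Kop alpha0 GRV GVV GVS).
Proof.
move=> l1 l2 a x y; apply: functional_extensionality => rs.
have fin k f g : Cmul k (csum (fun v => Cmul (vadd (vscale a f) g v) (GVS v rs.2)))
   = Cadd (Cmul a (Cmul k (csum (fun v => Cmul (f v) (GVS v rs.2)))))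
          (Cmul k (csum (fun v => Cmul (g v) (GVS v rs.2)))).
  rewrite CmulA (CmulC a k) -CmulA -CmulDr -csum_linear; congr (Cmul _ (csum _)).
  by apply: functional_extensionality => v; cc.
rewrite [RHS]/vadd [X in Cadd X _]/vscale; case: l1 => [|eta l1]; cbv beta;
  rewrite ?cat0s ?cat_cons !Kop_cons.
  rewrite -fin -chain_linear_weight; congr (Cmul _ (csum _)).
  apply: functional_extensionality => v; congr Cmul; congr (chain _ _ _ _).
  by apply: functional_extensionality => v0; cc.
by rewrite !size_cat /= -fin -chain_multilinear.
Qed.

Variables p q : ext.
Hypothesis pq : conjugate p q.
Hypothesis alpha0_gt0 : 0 < alpha0.

Lemma holderC (f g : Vt -> CC) :
  \big[Rplus/0]_(v : Vt) (Cmod (f v) * Cmod (g v)) <= lpnorm q f * lpnorm p g.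
Proof.
rewrite Rmult_comm; under eq_bigr do rewrite Rmult_comm.
by apply: (holder pq) => i; exact: Cmod_ge0.
Qed.

(** The l^1 norm of the row vector is propagated: after exchanging the two sums, Hölder pairs a row
    of [GVV] in l^q with the potential in l^p, and the maximum over rows makes the factor
    uniform. *)
Lemma chain_le w etas :
  \big[Rplus/0]_(v : Vt) Cmod (chain GVV w etas v) <=
  \big[Rplus/0]_(v : Vt) Cmod (w v) *
    ((\big[Rmax/0]_(v : Vt) lpnorm q (GVV v)) ^ size etas * \big[Rmult/1]_(eta <- etas) lpnorm p eta).
Proof.
have hmax := max_ge0 (fun v => lpnorm q (GVV v)).
elim: etas w => [|eta etas ih] w /=; first by rewrite big_nil; lra.
apply: Rle_trans (ih _) _; rewrite big_cons.
set A := \big[Rmult/1]_(_ <- _) _; set m := \big[Rmax/0]_(v : Vt) _.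
have hA : 0 <= A.
  by apply: (big_ind (fun x => 0 <= x)) => [|x y|i _]; [lra | exact: Rmult_le_pos | exact: lpnormR_ge0].
set W := \big[Rplus/0]_(v : Vt) Cmod (w _).
rewrite (_ : W * _ = W * (m * lpnorm p eta) * (m ^ size etas * A)); last by ring.
apply: Rmult_le_compat_r; first by apply: Rmult_le_pos => //; exact: pow_le.
apply: (@Rle_trans _ (\big[Rplus/0]_(v' : Vt) \big[Rplus/0]_(v : Vt)
   (Cmod (w v) * (Cmod (GVV v v') * Cmod (eta v'))))).
  apply: sum_le => v' _; rewrite Cmod_mul.
  under eq_bigr do rewrite -Rmult_assoc.
  rewrite -big_distrl /=; apply: Rmult_le_compat_r; first exact: Cmod_ge0.
  by apply: Rle_trans (Cmod_csum _ _) _; apply: sum_le => v _; rewrite Cmod_mul; lra.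
rewrite exchange_big /= /W big_distrl /=; apply: sum_le => v _.
rewrite -big_distrr /=; apply: Rmult_le_compat_l; first exact: Cmod_ge0.
apply: Rle_trans (holderC _ _) _; apply: Rmult_le_compat_r; first exact: lpnormR_ge0.
exact: (max_ge_term (fun v => lpnorm q (GVV v))).
Qed.

Lemma Kop_le eta etas : lpnorm p (Kop alpha0 GRV GVV GVS (eta :: etas)) <=
  nu_p alpha0 GRV GVS p q * mu_p alpha0 GVV q ^ size etas
    * \big[Rmult/1]_(e <- eta :: etas) lpnorm p e.
Proof.
have [hp hq] := conjugate_ge1 pq.
rewrite /nu_p /mu_p big_cons; set m := \big[Rmax/0]_(v : Vt) _.
set A := \big[Rmult/1]_(_ <- _) _.
set gR := fun r => lpnorm q (GRV r); set gS := fun s => lpnorm q (fun v => GVS v s).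
have hA : 0 <= A.
  by apply: (big_ind (fun x => 0 <= x)) => [|x y|i _]; [lra | exact: Rmult_le_pos | exact: lpnormR_ge0].
have hm : 0 <= m by exact: max_ge0.
have he := lpnormR_ge0 p (fun i => Cmod (eta i)); rewrite -/(lpnorm p eta) in he.
set k := alpha0 * (alpha0 * m) ^ size etas * (lpnorm p eta * A).
have hk : 0 <= k.
  by rewrite /k; apply: Rmult_le_pos; [apply: Rmult_le_pos; [lra | apply: pow_le; nra] | nra].
rewrite (_ : _ * _ * (_ * A) = Rabs k * (lpnormR p gR * lpnormR p gS)); last first.
  by rewrite Rabs_pos_eq // /k; ring.
have gR0 r : 0 <= gR r by exact: lpnormR_ge0.
have gS0 r : 0 <= gS r by exact: lpnormR_ge0.
apply: Rle_trans (Rmult_le_compat_l _ _ _ (Rabs_pos k) (lpnormR_tensor hp gR0 gS0)).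
apply: Rle_trans (lpnormR_scale_le _ _ hp).
apply: lpnormR_mono => // rs; rewrite Rabs_pos_eq; last exact: Cmod_ge0.
rewrite Kop_cons Cmod_mul Cmod_real Rabs_mult pow_1_abs Rmult_1_l Rabs_pos_eq; last by apply: pow_le; lra.
rewrite /k Rpow_mult_distr.
rewrite (_ : _ * (gR _ * gS _) = alpha0 ^ (size etas).+1 *
   (gR rs.1 * lpnorm p eta * (m ^ size etas * A) * gS rs.2)); last by rewrite /=; ring.
apply: Rmult_le_compat_l; first by apply: pow_le; lra.
apply: Rle_trans (Cmod_csum _ _) _.
under eq_bigr do rewrite Cmod_mul.
(* The last pairing is l^1 against the supremum of the source column, which its l^q norm dominates;
   the receiver row meets the first potential by Hölder. *)
apply: Rle_trans (sum_le_max_mul _ _) _ => [v|v|]; try exact: Cmod_ge0.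
apply: Rmult_le_compat.
- by apply: sum_ge0 => v _; exact: Cmod_ge0.
- exact: max_ge0.
- apply: Rle_trans (chain_le _ _) _; apply: Rmult_le_compat_r.
    by apply: Rmult_le_pos => //; exact: pow_le.
  by under eq_bigr do rewrite Cmod_mul; exact: holderC.
- rewrite -(lpnormR_inf (f := fun v => Cmod (GVS v rs.2))) => [|v]; last exact: Cmod_ge0.
  exact: sup_le_lpnormR.
Qed.

End KopLinear.

(** * Compositions of integers and the inverse Born operators *)

Lemma iota1_nat n : iota 1 n = index_iota 1 n.+1.
Proof. by rewrite /index_iota subn1. Qed.

Lemma big_compsS (T : Type) (idx : T) (op : Monoid.com_law idx) (G : seq nat -> T) m j :
  \big[op/idx]_(c <- comps m.+1 j) G c =
  \big[op/idx]_(1 <= i < j.+1) \big[op/idx]_(c <- comps m (j - i)%N) G (i :: c).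
Proof.
rewrite /= big_flatten big_map iota1_nat; apply: eq_bigr => i _.
by rewrite big_map.
Qed.

(** Both sides run over [a >= 1], [i >= 0] with [a + i <= n]; the right one groups by
    [k = a + i]. *)
Lemma sum_triangle (T : Type) (idx : T) (op : Monoid.com_law idx) (h : nat -> nat -> T) n :
  \big[op/idx]_(1 <= a < n.+1) \big[op/idx]_(0 <= i < (n - a).+1) h a i =
  \big[op/idx]_(1 <= k < n.+1) \big[op/idx]_(1 <= a < k.+1) h a (k - a)%N.
Proof.
elim: n => [|n ih]; first by rewrite !big_geq.
rewrite [RHS]big_nat_recr //= -ih big_nat_recr //= subnn big_nat1.
rewrite [X in _ = op _ X]big_nat_recr //= subnn Monoid.mulmA; congr (op _ _).
transitivity (\big[op/idx]_(1 <= a < n.+1)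
    op (\big[op/idx]_(0 <= i < (n - a).+1) h a i) (h a (n.+1 - a)%N)); last exact: big_split.
apply: congr_big_nat => // a /and3P[_ a1 an].
by rewrite subSn // big_nat_recr.
Qed.

Section Compositions.
Variable (I : Type).
Implicit Types (G : seq nat -> I -> CC).

Lemma comps_spec m j c : c \in comps m j -> [/\ size c = m, sumn c = j & all (leq 1) c].
Proof.
elim: m j c => [|m ih] j c /=; first by case: eqP => // ->; rewrite inE => /eqP ->.
case/flattenP => s /mapP[i]; rewrite mem_iota add1n ltnS => /andP[i0 ij] -> /mapP[c' hc ->] /=.
by have [-> -> ->] := ih _ _ hc; rewrite i0 subnKC.
Qed.

Lemma size_le_sumn c : all (leq 1) c -> (size c <= sumn c)%N.
Proof. by elim: c => //= a c ih /andP[a0 /ih h]; rewrite -add1n leq_add. Qed.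

Lemma comps_gt m j : (j < m)%N -> comps m j = [::].
Proof.
move=> jm; case e : (comps m j) => [|c s] //.
have /comps_spec[sc sj /size_le_sumn] : c \in comps m j by rewrite e mem_head.
by rewrite sc sj leqNgt jm.
Qed.

Lemma comps0S j : comps 0 j.+1 = [::].
Proof. by []. Qed.

Lemma big_comps1 G j : (0 < j)%N -> \vsum_(c <- comps 1 j) G c = G [:: j].
Proof.
case: j => // j _; rewrite big_compsS big_nat_recr //= subnn /= big_seq1.
rewrite big_nat big1 ?Monoid.mul1m // => i /andP[_ ij].
by rewrite subSn // big_nil.
Qed.

Lemma big_comps_diag G j : \vsum_(c <- comps j j) G c = G (nseq j 1%N).
Proof.
elim: j G => [|j ih] G; first by rewrite big_seq1.
rewrite big_compsS big_ltn // subn1 ih big_nat big1 ?Monoid.mulm1 // => i /andP[i1 ij].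
by rewrite comps_gt ?big_nil //; lia.
Qed.

(** Length zero is included and contributes only the empty composition of [0], the start of the
    inductions on degree. *)
Definition allcomps j := flatten [seq comps m j | m <- iota 0 j.+1].

Lemma big_allcomps_widen G M j : (j <= M)%N ->
  \vsum_(c <- allcomps j) G c = \big[@vadd I/@vzero I]_(0 <= m < M.+1) \vsum_(c <- comps m j) G c.
Proof.
move=> jM; rewrite big_flatten big_map (@big_cat_nat _ _ _ j.+1) //=.
rewrite [X in _ = vadd _ X]big_nat [X in _ = vadd _ X]big1 ?Monoid.mulm1 // => m /andP[jm _].
by rewrite comps_gt // big_nil.
Qed.

Lemma big_allcomps G j : \vsum_(c <- allcomps j) G c =
  \big[@vadd I/@vzero I]_(0 <= m < j.+1) \vsum_(c <- comps m j) G c.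
Proof. exact: big_allcomps_widen. Qed.

Lemma big_allcomps0 G : \vsum_(c <- allcomps 0) G c = G [::].
Proof. by rewrite big_seq1. Qed.

Lemma big_allcompsS G j : \vsum_(c <- allcomps j.+1) G c =
  \big[@vadd I/@vzero I]_(1 <= i < j.+2) \vsum_(c <- allcomps (j.+1 - i)) G (i :: c).
Proof.
rewrite big_allcomps big_ltn // comps0S big_nil Monoid.mul1m big_add1 -pred_Sn.
under eq_bigr do rewrite big_compsS.
rewrite exchange_big_nat /=; apply: congr_big_nat => // i /and3P[_ i1 ij].
by rewrite (@big_allcomps_widen _ j) //; lia.
Qed.

Lemma allcomps_gt0 j d : d \in allcomps j.+1 -> (0 < size d)%N.
Proof. by case/flattenP => s /mapP[m _ ->] /comps_spec[_]; case: d. Qed.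

(** Cutting a composition of [j] in two is the same as choosing a composition of some [i] and one of
    [j - i]. The induction peels off the first part, the cut at [0] being counted apart. *)
Lemma big_allcomps_split (F : seq nat -> seq nat -> I -> CC) j :
  \vsum_(d <- allcomps j) \big[@vadd I/@vzero I]_(0 <= i < (size d).+1) F (take i d) (drop i d) =
  \big[@vadd I/@vzero I]_(0 <= i < j.+1)
     \vsum_(d1 <- allcomps i) \vsum_(d2 <- allcomps (j - i)) F d1 d2.
Proof.
elim/ltn_ind: j F => -[|j] ih F.
  by rewrite big_allcomps0 !big_nat1 subn0 !big_allcomps0.
rewrite big_allcompsS; under eq_bigr => a _ do under eq_bigr => d _ do
  rewrite /= big_ltn // take0 drop0 big_add1 /=.
under eq_bigr => a _ do rewrite big_split /=.
rewrite big_split /= -(big_allcompsS (fun d => F [::] d)).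
rewrite [RHS]big_ltn // subn0 big_allcomps0; congr vadd.
transitivity (\big[@vadd I/@vzero I]_(1 <= a < j.+2) \big[@vadd I/@vzero I]_(0 <= i < (j.+1 - a).+1)
   \vsum_(d1 <- allcomps i) \vsum_(d2 <- allcomps (j.+1 - (a + i))) F (a :: d1) d2).
  apply: congr_big_nat => // a /and3P[_ a1 aj].
  rewrite (ih (j.+1 - a)%N _ (fun d1 d2 => F (a :: d1) d2)); last by lia.
  by apply: eq_bigr => i _; rewrite subnDA.
rewrite sum_triangle; apply: congr_big_nat => // -[|k] // /and3P[_ _ kj].
rewrite big_allcompsS; apply: congr_big_nat => // a /and3P[_ a1 ak].
by rewrite subnKC //; lia.
Qed.

End Compositions.

Lemma size_blocks A c (l : seq A) : size (blocks c l) = size c.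
Proof. by elim: c l => //= i c ih l; rewrite ih. Qed.

Lemma blocks_map A B (h : A -> B) c l : blocks c (map h l) = map (map h) (blocks c l).
Proof. by elim: c l => //= i c ih l; rewrite -map_take -map_drop ih. Qed.

Lemma blocks_singletons A (l : seq A) : blocks (nseq (size l) 1%N) l = map (fun a => [:: a]) l.
Proof. by elim: l => //= a l ih; rewrite take0 drop0 ih. Qed.

(** The surrounding pieces are chosen before [x]: a slot has a fixed place in one fixed block, so
    linearity in that slot passes through [blocks]. *)
Lemma blocks_mid A c (l1 l2 : seq A) : (size l1 < sumn c)%N ->
  exists B1 u1 u2 B2, forall x, blocks c (l1 ++ x :: l2) = B1 ++ (u1 ++ x :: u2) :: B2.
Proof.
elim: c l1 => //= i c ih l1 h; case: (ltnP (size l1) i) => hi.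
  exists [::], l1, (take (i - (size l1).+1) l2), (blocks c (drop (i - (size l1).+1) l2)) => x /=.
  rewrite take_cat drop_cat ltnNge (ltnW hi) /=.
  have -> : (i - size l1)%N = (i - (size l1).+1).+1 by lia.
  by [].
have [|B1 [u1 [u2 [B2 e]]]] := ih (drop i l1); first by rewrite size_drop; lia.
exists (take i l1 :: B1), u1, u2, B2 => x /=; rewrite take_cat drop_cat.
case: (ltnP i (size l1)) => hi'; first by rewrite e.
have {}hi : i = size l1 by lia.
by subst i; rewrite subnn take0 drop0 cats0 take_size -e drop_size.
Qed.

(* Composing two families of multilinear maps: a composition of [j] whose parts are themselves
   composed is the same as a composition of [j] cut into consecutive blocks. *)
Lemma big_allcomps_blocks (I J L : Type) (x : nat -> I -> CC) (k : seq (I -> CC) -> J -> CC)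
  (g : seq (J -> CC) -> L -> CC) j : multilinear g ->
  \vsum_(c <- allcomps j) g (map (fun i => \vsum_(d <- allcomps i) k (map x d)) c) =
  \vsum_(d <- allcomps j) \vsum_(e <- allcomps (size d)) g (map k (blocks e (map x d))).
Proof.
elim/ltn_ind: j g => -[|j] ih g lg; first by rewrite !big_allcomps0.
set y := fun i => \vsum_(d <- allcomps i) k (map x d).
(* The first block is never empty, hence the value zero for the cut at position [0]. *)
pose F d1 d2 := if d1 is [::] then @vzero L else
  \vsum_(e <- allcomps (size d2)) g (k (map x d1) :: map k (blocks e (map x d2))).
transitivity (\vsum_(d <- allcomps j.+1)
    \big[@vadd L/@vzero L]_(0 <= i < (size d).+1) F (take i d) (drop i d)); last first.
  rewrite big_seq [RHS]big_seq; apply: eq_bigr => d /allcomps_gt0.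
  case: d => // a d _; rewrite big_ltn // take0 Monoid.mul1m /= big_allcompsS.
  apply: congr_big_nat => // -[|i] // /and3P[_ _ hi]; rewrite /= subSS size_drop; apply: eq_bigr => e _.
  by rewrite map_take map_drop.
rewrite big_allcomps_split big_ltn // big_allcomps0 [X in vadd X _]big1 ?Monoid.mul1m //.
rewrite big_allcompsS; apply: congr_big_nat => // -[|i] // /and3P[_ _ hi].
have lgi z : multilinear (fun l => g (z :: l)) by move=> l1 l2; exact: (lg (z :: l1) l2).
rewrite (ih (j.+1 - i.+1)%N _ (fun l => g (y i.+1 :: l))) //; last by lia.
rewrite [RHS]exchange_big /=; apply: eq_bigr => d _.
transitivity (\vsum_(d1 <- allcomps i.+1)
   \vsum_(e <- allcomps (size d)) g (k (map x d1) :: map k (blocks e (map x d)))); last first.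
  by rewrite big_seq [RHS]big_seq; apply: eq_bigr => d1 /allcomps_gt0; case: d1.
rewrite exchange_big /=; apply: eq_bigr => e _.
exact: (linear_sum (lg [::] _)).
Qed.

(** * The inverse Born operators as a two-sided formal inverse *)

Section InverseOperators.
Variables (Vt Rt St : finType) (alpha0 : R)
  (GRV : Rt -> Vt -> CC) (GVV : Vt -> Vt -> CC) (GVS : Vt -> St -> CC)
  (K1inv : (Rt * St -> CC) -> (Vt -> CC)).
Notation K := (Kop alpha0 GRV GVV GVS).
Notation K1_ := (K1 alpha0 GRV GVV GVS).
Notation KiF := (KinvF alpha0 GRV GVV GVS K1inv).
Notation Ki := (Kinv alpha0 GRV GVV GVS K1inv).
Hypothesis K1K : forall eta, K1inv (K1_ eta) = eta.
Hypothesis K1invK : forall phi, K1_ (K1inv phi) = phi.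

Lemma K1_linear : linear K1_.
Proof. exact: (Kop_multilinear alpha0 GRV GVV GVS [::] [::]). Qed.

Lemma K1inv_linear : linear K1inv.
Proof. by move=> a x y; rewrite -{1}(K1invK x) -{1}(K1invK y) -K1_linear K1K. Qed.

Lemma KinvFS k phis : size phis != 1%N -> KiF k.+1 phis =
  vopp (\big[@vadd Vt/@vzero Vt]_(1 <= m < size phis) \vsum_(c <- comps m (size phis))
     KiF k (map (fun b => K (map K1inv b)) (blocks c phis))).
Proof.
move=> s1; have -> : KiF k.+1 phis = vopp (vsum (flatten (map (fun m =>
                 map (fun c => KiF k (map (fun b => K (map K1inv b)) (blocks c phis)))
                     (comps m (size phis)))
               (iota 1 (size phis).-1)))) by case: phis s1 => [|? []].
congr vopp; rewrite vsum_big big_flatten big_map /index_iota subn1; apply: eq_bigr => m _.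
by rewrite big_map.
Qed.

(** A recursive call receives [m] blocks with [m < size phis], so fuel equal to the length never
    runs out. *)
Lemma KinvF_fuel k k' phis : (size phis <= k)%N -> (size phis <= k')%N -> KiF k phis = KiF k' phis.
Proof.
have nilF n : KiF n [::] = @vzero Vt.
  case: n => // n; rewrite KinvFS // big_geq //.
  by apply: functional_extensionality => v; cc.
elim: k k' phis => [|k ih] [|k'] phis hk hk' //.
- by move: hk; rewrite leqn0 => /nilP ->; rewrite nilF.
- by move: hk'; rewrite leqn0 => /nilP ->; rewrite nilF.
have [s1|s1] := eqVneq (size phis) 1%N; first by case: phis s1 {hk hk'} => [|? []].
rewrite !KinvFS //; congr vopp; apply: congr_big_nat => // m /and3P[_ m1 mn].
rewrite big_seq [RHS]big_seq; apply: eq_bigr => c /comps_spec[sc _ _].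
by apply: ih; rewrite size_map size_blocks sc; lia.
Qed.

Lemma Kinv_rec phis : (1 < size phis)%N -> Ki phis =
  vopp (\big[@vadd Vt/@vzero Vt]_(1 <= m < size phis) \vsum_(c <- comps m (size phis))
     Ki (map (fun b => K (map K1inv b)) (blocks c phis))).
Proof.
move=> s1; rewrite /Kinv; case e : (size phis) s1 => [|n] // s1; rewrite KinvFS ?e; last by lia.
congr vopp; apply: congr_big_nat => // m /and3P[_ m1 mn].
rewrite big_seq [RHS]big_seq; apply: eq_bigr => c /comps_spec[sc _ _].
by apply: KinvF_fuel; rewrite size_map size_blocks sc //; lia.
Qed.

Lemma KinvF_multilinear k : multilinear (KiF k).
Proof.
elim: k => [|k ih] l1 l2 a x y; cbv beta.
  by apply: functional_extensionality => v; cc.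
have [s1|s1] := eqVneq (size (l1 ++ x :: l2)) 1%N.
  case: l1 s1 => [|b l1]; last by rewrite /= size_cat /= addnS.
  by case: l2 => // _; exact: K1inv_linear.
have sz z : size (l1 ++ z :: l2) = size (l1 ++ x :: l2) by rewrite !size_cat.
rewrite !KinvFS ?sz //; move: (size _) s1 sz => n s1 sz.
have voppL : linear (@vopp Vt) by move=> b f g; apply: functional_extensionality => v; cc.
rewrite -voppL; congr vopp.
have vscale_linear : linear (vscale a : (Vt -> CC) -> Vt -> CC).
  by move=> b f g; apply: functional_extensionality => v; cc.
rewrite (linear_sum vscale_linear) -big_split /=; apply: eq_bigr => m _.
rewrite (linear_sum vscale_linear) -big_split /= big_seq [RHS]big_seq.
apply: eq_bigr => c /comps_spec[_ hc _].
have [|B1 [u1 [u2 [B2 e]]]] := @blocks_mid _ c l1 l2.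
  by rewrite hc -(sz x) size_cat /=; lia.
rewrite !e !map_cat /= !map_cat /= K1inv_linear (Kop_multilinear _ _ _ _ (map K1inv u1)).
exact: ih.
Qed.

Lemma Kinv_multilinear : multilinear Ki.
Proof.
move=> l1 l2 a x y; have sz z : size (l1 ++ z :: l2) = size (l1 ++ x :: l2) by rewrite !size_cat.
by rewrite /Kinv !sz; exact: KinvF_multilinear.
Qed.

(** The all-ones composition gives the inverse operator at the vectors [K_1 eta_i]. Its recursion,
    with [K1inv] undoing each [K_1], is minus the sum over all shorter compositions, so everything
    cancels beyond degree one. *)
Lemma Kinv_left_inverse etas : (0 < size etas)%N ->
  \vsum_(c <- allcomps (size etas)) Ki (map K (blocks c etas)) =
  if etas is [:: eta] then eta else @vzero Vt.
Proof.
case: etas => // eta [|eta2 etas] _.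
  rewrite big_allcomps /= big_ltn // big_nat1 /= big_nil big_seq1 Monoid.mul1m /=.
  exact: K1K.
set l := eta :: eta2 :: etas; rewrite big_allcomps big_ltn // comps0S big_nil Monoid.mul1m.
rewrite big_nat_recr // big_comps_diag blocks_singletons -map_comp.
rewrite -/l (Kinv_rec (phis := map (K \o (fun e => [:: e])) l)) ?size_map //.
rewrite (_ : \big[_/_]_(1 <= i < size l) _ = \big[@vadd Vt/@vzero Vt]_(1 <= m < size l)
  \vsum_(c <- comps m (size l)) Ki (map (fun b => K (map K1inv b))
    (blocks c (map (K \o (fun e => [:: e])) l)))); last first.
  apply: eq_bigr => m _; apply: eq_bigr => c _; congr Ki.
  rewrite blocks_map -map_comp; apply: eq_map => b /=.
  by rewrite -map_comp (eq_map (g := id)) ?map_id // => e /=; exact: K1K.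
by apply: functional_extensionality => v; cc.
Qed.

Variable phi : Rt * St -> CC.
Notation x := (fun j => Ki (nseq j phi)).

(** This is what makes the nonlinear terms of degree [j] depend on earlier terms only. *)
Lemma comps_mem m j c t : c \in comps m j -> (1 < m)%N -> t \in c -> (t < j)%N.
Proof.
move=> /comps_spec[sc sj ac] m1 /splitPr tc; case: tc sc sj ac => c1 c2.
rewrite size_cat sumn_cat all_cat /= => sc sj /and3P[/size_le_sumn h1 _ /size_le_sumn h2].
by lia.
Qed.

(* The inverse Born operators also invert the Born operators from the right: substituting [x]
   into the left inversion identity forces the [j]-th defect to be killed by [K1inv]. *)
Lemma Kinv_right_inverse j :
  \vsum_(d <- allcomps j) K (map x d) = if j == 1%N then phi else @vzero (Rt * St).
Proof.
elim/ltn_ind: j => -[|[|j]] ih; first by rewrite big_allcomps0.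
  rewrite big_allcomps /= big_ltn // big_nat1 /= big_nil big_seq1 Monoid.mul1m /=.
  exact: K1invK.
set n := j.+2; set y := fun i => \vsum_(d <- allcomps i) K (map x d).
(* The same double substitution is evaluated twice: here by regrouping and the left inverse, in [e2]
   by the induction hypothesis on [y]. *)
have e1 : \vsum_(c <- allcomps n) Ki (map y c) = x n.
  rewrite (big_allcomps_blocks _ _ _ Kinv_multilinear).
  transitivity (\vsum_(d <- allcomps n) if d is [:: i] then x i else @vzero Vt).
    rewrite big_seq [RHS]big_seq; apply: eq_bigr => d /allcomps_gt0 d0.
    rewrite -[in allcomps _](size_map x d) Kinv_left_inverse ?size_map //.
    by case: d d0 => [|? []].
  rewrite big_allcomps big_ltn // comps0S big_nil Monoid.mul1m big_ltn // big_comps1 //.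
  rewrite big_nat big1 ?Monoid.mulm1 // => m /andP[m2 _].
  rewrite big_seq big1 // => c /comps_spec[sc _ _]; move: m2; rewrite -sc.
  by case: c {sc} => [|? []].
have e2 : \vsum_(c <- allcomps n) Ki (map y c) = vadd (K1inv (y n)) (x n).
  rewrite big_allcomps big_ltn // comps0S big_nil Monoid.mul1m big_ltn // big_comps1 //.
  congr vadd; rewrite big_nat_recr // big_comps_diag.
  rewrite (_ : map y (nseq n 1%N) = nseq n phi); last first.
    by rewrite map_nseq /y ih.
  suff -> : \big[@vadd Vt/@vzero Vt]_(2 <= m < n) \vsum_(c <- comps m n) Ki (map y c) = @vzero Vt.
    exact: Monoid.mul1m.
  rewrite big_nat big1 // => m /andP[m2 mn].
  rewrite big_seq big1 // => c hc.
  have [sc sj ac] := comps_spec hc.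
  (* With fewer than [n] parts some part is at least [2], and with at least two parts it is below
     [n]; there [y] vanishes by induction. *)
  have /hasP[t tc t1] : has (leq 2) c.
    apply/negPn/negP => /hasPn h.
    suff : sumn c = size c by lia.
    elim: c ac h {hc sc sj} => //= a c ihc /andP[a0 ac] h; rewrite ihc //; last first.
      by move=> b bc; apply: h; rewrite inE bc orbT.
    by have := h a (mem_head _ _); lia.
  apply: (multilinear_zero Kinv_multilinear tc).
  rewrite /y ih; last exact: comps_mem hc m2 tc.
  by case: eqP t1 => // ->.
have K0 : K1inv (y n) = @vzero Vt.
  have := e2; rewrite e1 => h; apply: functional_extensionality => v.
  have := congr1 (fun f => f v) h; rewrite /vadd => hv.
  have := congr1 Cre hv; have := congr1 Cim hv => /= h1 h2.
  by apply: CC_ext => /=; lra.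
by rewrite -/y -[LHS]K1invK -/(y n) K0 (linear0 K1_linear).
Qed.

End InverseOperators.

(** * Scalar majorants and the constants *)

Definition prodR (a : nat -> R) (c : seq nat) := \big[Rmult/1]_(i <- c) a i.

Lemma prodR_ge0 a c : (forall i, 0 <= a i) -> 0 <= prodR a c.
Proof. by move=> ha; apply: (big_ind (fun x => 0 <= x)) => // *; [lra | exact: Rmult_le_pos]. Qed.

Lemma sum_nat_le (F G : nat -> R) m n : (forall i, (m <= i < n)%N -> F i <= G i) ->
  \big[Rplus/0]_(m <= i < n) F i <= \big[Rplus/0]_(m <= i < n) G i.
Proof. by move=> h; apply: sum_le => i; rewrite mem_index_iota; exact: h. Qed.

Lemma sum_nat_ge0 (F : nat -> R) m n : (forall i, (m <= i < n)%N -> 0 <= F i) ->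
  0 <= \big[Rplus/0]_(m <= i < n) F i.
Proof. by move=> h; apply: sum_ge0 => i; rewrite mem_index_iota; exact: h. Qed.

Lemma sum_nat_widen (F : nat -> R) m n n' : (n <= n')%N -> (forall i, 0 <= F i) ->
  \big[Rplus/0]_(m <= i < n) F i <= \big[Rplus/0]_(m <= i < n') F i.
Proof.
move=> nn hF; case: (leqP m n) => mn.
  rewrite (@big_cat_nat _ _ _ n _ n') //=.
  by have := @sum_nat_ge0 F n n' (fun i _ => hF i); lra.
by rewrite big_geq 1?ltnW //; exact: sum_nat_ge0.
Qed.

(** Expanding the power gives all [m]-tuples with entries in [1..J]; the left side keeps those with
    sum at most [J]. *)
Lemma sum_comps_le (a : nat -> R) m J : (forall i, 0 <= a i) ->
  \big[Rplus/0]_(0 <= j < J.+1) \big[Rplus/0]_(c <- comps m j) prodR a c <=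
  (\big[Rplus/0]_(1 <= i < J.+1) a i) ^ m.
Proof.
move=> ha; set S := \big[Rplus/0]_(1 <= i < J.+1) a i.
have S0 : 0 <= S by apply: sum_nat_ge0 => i _.
elim: m => [|m ih].
  rewrite big_ltn //= big_seq1 /prodR big_nil big1_seq; first lra.
  by move=> [|j]; rewrite ?mem_index_iota // big_nil.
under eq_bigr do rewrite big_compsS.
rewrite big_ltn // (@big_geq _ _ _ 1 1) // Rplus_0_l.
rewrite -(sum_triangle _ (fun i j => \big[Rplus/0]_(c <- comps m j) prodR a (i :: c))).
rewrite [X in _ <= X](_ : _ = \big[Rplus/0]_(1 <= i < J.+1) (a i * S ^ m)); last first.
  by rewrite -big_distrl.
apply: sum_nat_le => i _.
under eq_bigr => j _ do under eq_bigr do rewrite /prodR big_cons.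
under eq_bigr do rewrite -big_distrr /=.
rewrite -big_distrr /=; apply: Rmult_le_compat_l => //.
apply: Rle_trans ih; apply: sum_nat_widen => [|j]; first by lia.
by apply: sum_ge0 => c _; exact: prodR_ge0.
Qed.

Lemma geom_le u n : 0 <= u < 1 -> \big[Rplus/0]_(0 <= k < n) u ^ k <= / (1 - u).
Proof.
move=> hu; suff : \big[Rplus/0]_(0 <= k < n) u ^ k <= (1 - u ^ n) * / (1 - u).
  have := pow_le u n (proj1 hu).
  have : 0 < / (1 - u) by apply: Rinv_0_lt_compat; lra.
  nra.
elim: n => [|n ih]; first by rewrite big_geq //=; lra.
rewrite big_nat_recr //=; apply: Rle_trans (Rplus_le_compat_r _ _ _ ih) _.
apply: Req_le; field; lra.
Qed.

(* The constants of the theorem in terms of [w = sqrt (1 + C / nu)]: then [nu = C / (w^2 - 1)],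
   [mu R_star = (w - 1) / w] and [mu r_p / C = (w - 1) / (w + 1)]. *)
Lemma constants C nu mu : 0 < C -> 0 < nu -> 0 < mu ->
  exists w, [/\ 1 < w, nu * (w * w - 1) = C, mu * R_star C nu mu * w = w - 1
    & mu * r_p C nu mu * (w + 1) = C * (w - 1)].
Proof.
move=> hC hnu hmu; pose w := sqrt (1 + C / nu); exists w.
have hq : 0 < C / nu by apply: Rdiv_lt_0_compat.
have ww : w * w = 1 + C / nu by apply: sqrt_sqrt; lra.
have w1 : 1 < w by have : 0 <= w := sqrt_pos _; nra.
have eC : C = nu * (w * w - 1) by rewrite ww; field; lra.
split => //.
- rewrite /R_star /lambda_star -/w {}eC; field; repeat split; nra.
- rewrite /r_p -/w.
  have -> : nu / C = / (w * w - 1) by rewrite eC; field; repeat split; nra.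
  by field; repeat split; nra.
Qed.

(** * Roots of unity and Cauchy's estimate *)

Definition cis t := mkC (cos t) (sin t).

Lemma Cmod_cis t : Cmod (cis t) = 1.
Proof.
rewrite /Cmod /= -[RHS]sqrt_1; congr sqrt.
by have := sin2_cos2 t; rewrite /Rsqr; lra.
Qed.

Lemma cis_add s t : cis (s + t) = Cmul (cis s) (cis t).
Proof. by rewrite /cis /Cmul /= cos_plus sin_plus; congr mkC; ring. Qed.

Lemma cis0 : cis 0 = Cone.
Proof. by rewrite /cis cos_0 sin_0. Qed.

Lemma iter_cis t n : iter n (Cmul (cis t)) Cone = cis (INR n * t).
Proof.
elim: n => [|n ih]; first by rewrite /= Rmult_0_l cis0.
by rewrite iterS ih -cis_add S_INR; congr cis; ring.
Qed.

Lemma iter_Cmul_real a n : iter n (Cmul (mkC a 0)) Cone = mkC (a ^ n) 0.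
Proof. by elim: n => //= n ->; apply: CC_ext => /=; ring. Qed.

Lemma cis_2PI n : cis (INR n * (2 * PI)) = Cone.
Proof.
rewrite -iter_cis; have -> : cis (2 * PI) = Cone by rewrite /cis cos_2PI sin_2PI.
by elim: n => //= n ->; cc.
Qed.

Lemma cis_opp t : cis t = Cone -> cis (- t) = Cone.
Proof. by move=> [h1 h2]; rewrite /cis cos_neg sin_neg h1 h2 Ropp_0. Qed.

Lemma cos_neq1 d : d <> 0 -> - (2 * PI) < d < 2 * PI -> cos d <> 1.
Proof.
move=> d0 hd e; have : cos d = 1 - 2 * sin (d / 2) * sin (d / 2).
  by rewrite -cos_2a_sin; congr cos; field.
rewrite e; case: (Rlt_le_dec 0 d) => hd'.
  by have := sin_gt_0 (d / 2) ltac:(lra) ltac:(lra); nra.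
have := sin_gt_0 (- (d / 2)) ltac:(lra) ltac:(lra); rewrite sin_neg; nra.
Qed.

(** Multiplying the geometric sum by the nonzero number [cis d - 1] telescopes it to zero. *)
Lemma sum_cis d n : cos d <> 1 -> cis (INR n * d) = Cone ->
  \big[Cadd/C0]_(0 <= k < n) cis (INR k * d) = C0.
Proof.
move=> hd hn.
have tele m : Cmul (Csub (cis d) Cone) (\big[Cadd/C0]_(0 <= k < m) cis (INR k * d)) =
    Csub (cis (INR m * d)) Cone.
  elim: m => [|m ih]; first by rewrite big_geq //= Rmult_0_l cis0; cc.
  rewrite big_nat_recr // CmulDr ih S_INR Rmult_plus_distr_r Rmult_1_l cis_add.
  by cc.
apply: Cmod_eq0; have := congr1 Cmod (tele n); rewrite hn Cmod_mul.
have -> : Csub Cone Cone = C0 by cc.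
rewrite Cmod0 => /Rmult_integral[] // /Cmod_eq0 [h _]; exfalso; apply: hd; lra.
Qed.

(* Averaging over the roots of unity of order [N + 1] isolates [c m]. *)
Lemma cauchy_estimate N (c : nat -> CC) B :
  (forall t, Cmod (\big[Cadd/C0]_(1 <= l < N.+1) Cmul (cis (INR l * t)) (c l)) <= B) ->
  forall m, (1 <= m <= N)%N -> Cmod (c m) <= B.
Proof.
move=> hB m /andP[m1 mN]; set n := INR N.+1; set t := 2 * PI / n.
have n0 : 0 < n by apply: lt_0_INR; lia.
have nt : n * t = 2 * PI by rewrite /t; field; lra.
have t0 : 0 < t by apply: Rdiv_lt_0_compat => //; have := PI_RGT_0; lra.
have e : \big[Cadd/C0]_(0 <= k < N.+1) Cmul (cis (- (INR m * (INR k * t))))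
    (\big[Cadd/C0]_(1 <= l < N.+1) Cmul (cis (INR l * (INR k * t))) (c l)) = Cmul (mkC n 0) (c m).
  under eq_bigr do rewrite big_distrr /=.
  rewrite exchange_big_nat /=.
  transitivity (\big[Cadd/C0]_(1 <= l < N.+1) if l == m then Cmul (mkC n 0) (c m) else C0); last first.
    rewrite (@big_cat_nat _ _ _ m) //=; last by lia.
    rewrite [X in Cadd X _]big_nat [X in Cadd X _]big1 => [|i /andP[_ im]]; last by rewrite ltn_eqF.
    rewrite big_ltn ?eqxx; last by lia.
    rewrite [X in Cadd _ (Cadd _ X)]big_nat [X in Cadd _ (Cadd _ X)]big1 => [|i /andP[im _]].
      by cc.
    by rewrite gtn_eqF.
  apply: congr_big_nat => // l /and3P[_ l1 lN].
  transitivity (Cmul (\big[Cadd/C0]_(0 <= k < N.+1) cis (INR k * ((INR l - INR m) * t))) (c l)).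
    rewrite big_distrl /=; apply: eq_bigr => k _; rewrite CmulA -cis_add.
    by congr (Cmul (cis _) _); ring.
  case: eqP => [->|lm].
    congr Cmul; under eq_bigr do rewrite Rminus_diag Rmult_0_l Rmult_0_r cis0.
    rewrite /n; elim: N.+1 => [|k ih]; first by rewrite big_geq.
    by rewrite big_nat_recr // ih S_INR; cc.
  rewrite sum_cis ?Cmul0l //.
    (* Indices in [1..N] differ by less than the number [N + 1] of nodes, so the angle stays
       strictly within a full turn and no other index aliases to [m]. *)
    have lm' : INR l - INR m <> 0 by move=> h; apply: lm; apply: INR_eq; lra.
    have h1 : INR l < n by apply: lt_INR; lia.
    have h2 : INR m < n by apply: lt_INR; lia.
    have h3 := pos_INR l; have h4 := pos_INR m.
    apply: cos_neq1; first by apply: Rmult_integral_contrapositive; split; lra.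
    by rewrite -nt; split; nra.
  rewrite -/n (_ : n * _ = INR l * (2 * PI) + - (INR m * (2 * PI))); last by rewrite -nt; ring.
  by rewrite cis_add cis_2PI cis_opp ?cis_2PI // Cmul1.
have := congr1 Cmod e; rewrite Cmod_mul Cmod_real Rabs_pos_eq => [he|]; last lra.
apply: (Rmult_le_reg_l n) => //; rewrite -he; apply: Rle_trans (Cmod_csum _ _) _.
apply: (@Rle_trans _ (\big[Rplus/0]_(0 <= k < N.+1) B)).
  by apply: sum_nat_le => k _; rewrite Cmod_mul Cmod_cis Rmult_1_l.
rewrite /n; elim: N.+1 => [|k ih]; first by rewrite big_geq //=; lra.
by rewrite big_nat_recr // S_INR /=; lra.
Qed.

(** The norm is at most the sum of the moduli of finitely many coordinates, which are handled one by
    one. *)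
Lemma vconv_lpnorm (I : finType) p (u : nat -> I -> CC) l : ext_ge1 p -> vconv u l ->
  forall eps, 0 < eps -> exists n0, forall n, (n0 <= n)%N -> lpnorm p (vsub (u n) l) < eps.
Proof.
move=> hp hu; suff h (s : seq I) : forall eps, 0 < eps -> exists n0, forall n, (n0 <= n)%N ->
    \big[Rplus/0]_(i <- s) Cmod (vsub (u n) l i) < eps.
  move=> eps e0; have [n0 hn] := h (index_enum I) eps e0; exists n0 => n /hn.
  exact: Rle_lt_trans (lpnorm_le_sum hp _).
elim: s => [|i s ih] eps e0; first by exists 0%N => n _; rewrite big_nil.
have [n1 h1] := ih (eps / 2) ltac:(lra).
have [n2 h2] := hu i (eps / 2) ltac:(lra).
exists (maxn n1 n2) => n; rewrite geq_max => /andP[/h1 g1 /leP /h2].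
rewrite /R_dist Rminus_0_r Rabs_pos_eq; last exact: Cmod_ge0.
by rewrite big_cons /vsub in g1 * => g2; lra.
Qed.

Lemma lpnorm_le_vsub (I : finType) p (f g : I -> CC) : ext_ge1 p ->
  lpnorm p f <= lpnorm p g + lpnorm p (vsub g f).
Proof.
move=> hp; have {1}-> : f = vadd g (vopp (vsub g f)).
  by apply: functional_extensionality => i; cc.
by apply: Rle_trans (lpnorm_triangle hp _ _) _; rewrite lpnorm_opp; lra.
Qed.

Lemma bounded_sum_tail (a : nat -> R) B : (forall i, 0 <= a i) ->
  (forall n, \big[Rplus/0]_(1 <= i < n.+1) a i <= B) ->
  forall eps, 0 < eps -> exists n0, forall N n, (n0 <= N <= n)%N ->
    \big[Rplus/0]_(N.+1 <= i < n.+1) a i <= eps.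
Proof.
move=> a0 hB eps e0; pose s n := \big[Rplus/0]_(1 <= i < n.+1) a i.
have gs : Un_growing s by move=> n; rewrite /s [X in _ <= X]big_nat_recr //=; have := a0 n.+1; lra.
have [l hl] : exists l, Un_cv s l.
  by apply: Un_cv_crit => //; exists B => y [n ->]; exact: hB.
have [n0 hn0] := hl eps e0; exists n0 => N n /andP[hN Nn].
have := growing_ineq s l gs hl n; have := hn0 N ltac:(by apply/leP).
rewrite /R_dist => /Rabs_def2[_ h1] h2.
have : s n = s N + \big[Rplus/0]_(N.+1 <= i < n.+1) a i by rewrite /s -big_cat_nat.
by lra.
Qed.

(** * Convergence and error of the inverse Born series *)

Section InverseBornSeries.
Variables (Vt Rt St : finType) (p q : ext) (alpha0 : R)
  (GRV : Rt -> Vt -> CC) (GVV : Vt -> Vt -> CC) (GVS : Vt -> St -> CC)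
  (K1inv : (Rt * St -> CC) -> (Vt -> CC)) (C : R).
Notation K := (Kop alpha0 GRV GVV GVS).
Notation K1_ := (K1 alpha0 GRV GVV GVS).
Notation Ki := (Kinv alpha0 GRV GVV GVS K1inv).
Notation nu := (nu_p alpha0 GRV GVS p q).
Notation mu := (mu_p alpha0 GVV q).
Notation r := (r_p C nu mu).
Notation Rs := (R_star C nu mu).
Notation x phi j := (Ki (nseq j phi)).
Hypothesis pq : conjugate p q.
Hypothesis alpha0_gt0 : 0 < alpha0.
Hypothesis K1K : forall eta, K1inv (K1_ eta) = eta.
Hypothesis K1invK : forall phi, K1_ (K1inv phi) = phi.
Hypothesis nu_gt0 : 0 < nu.
Hypothesis mu_gt0 : 0 < mu.
Hypothesis C_attained : exists eta, lpnorm p eta = 1 /\ lpnorm p (K1_ eta) = C.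
Hypothesis C_min : forall eta, lpnorm p eta = 1 -> C <= lpnorm p (K1_ eta).

Let hp : ext_ge1 p := proj1 (conjugate_ge1 pq).

(** The minimum is attained, so [C = 0] would put a unit vector into the kernel of [K_1]. *)
Lemma C_gt0 : 0 < C.
Proof.
have [eta [e1 eC]] := C_attained; have := lpnorm_ge0 p (K1_ eta); rewrite eC => C0.
case: (Req_dec C 0) => [Cz|]; last lra.
move: eC; rewrite Cz => /(lpnorm_eq0 hp) K0; move: e1.
by rewrite -(K1K eta) K0 (linear0 (K1inv_linear K1K K1invK)) lpnorm_zero //; lra.
Qed.

Lemma K1_ge eta : C * lpnorm p eta <= lpnorm p (K1_ eta).
Proof.
have h0 := lpnorm_ge0 p eta; have hC := C_gt0; have hk := lpnorm_ge0 p (K1_ eta).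
case: (Req_dec (lpnorm p eta) 0) => [->|n0]; first lra.
have hi : 0 < / lpnorm p eta by apply: Rinv_0_lt_compat; lra.
have m : Cmod (mkC (/ lpnorm p eta) 0) = / lpnorm p eta by rewrite Cmod_real Rabs_pos_eq; lra.
have := C_min (eta := vscale (mkC (/ lpnorm p eta) 0) eta).
rewrite (linearZ (K1_linear _ _ _ _)) !lpnorm_scale // m Rinv_l // => /(_ erefl) h.
apply: (Rmult_le_reg_l (/ lpnorm p eta)) => //.
have -> : / lpnorm p eta * (C * lpnorm p eta) = C by field.
exact: h.
Qed.

Lemma K1inv_le phi : C * lpnorm p (K1inv phi) <= lpnorm p phi.
Proof. by have := K1_ge (K1inv phi); rewrite K1invK. Qed.

Lemma Kop_le_prod (y : nat -> Vt -> CC) c : (0 < size c)%N ->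
  lpnorm p (K (map y c)) <= nu * mu ^ (size c).-1 * prodR (fun i => lpnorm p (y i)) c.
Proof.
case: c => // i c _; apply: Rle_trans (Kop_le _ _ _ pq alpha0_gt0 _ _) _.
by rewrite -(map_cons y) size_map /prodR big_map /=; lra.
Qed.

Lemma sum_Kop_le (y : nat -> Vt -> CC) m j : (0 < m)%N ->
  lpnorm p (\vsum_(c <- comps m j) K (map y c)) <=
  nu * mu ^ m.-1 * \big[Rplus/0]_(c <- comps m j) prodR (fun i => lpnorm p (y i)) c.
Proof.
move=> m0; apply: Rle_trans (lpnorm_sum _ _ hp) _; rewrite big_distrr /=.
apply: sum_le => c /comps_spec[sc _ _].
by have := @Kop_le_prod y c; rewrite sc; exact.
Qed.

Lemma x1_le phi : C * lpnorm p (x phi 1) <= lpnorm p phi.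
Proof. exact: K1inv_le. Qed.

(** In the right-inverse identity of degree [j] the one-part composition is [K_1 x_j]; the others
    move across, and [K_1] is bounded below by [C]. *)
Lemma xS_le phi j : (1 < j)%N -> C * lpnorm p (x phi j) <=
  \big[Rplus/0]_(2 <= m < j.+1)
    (nu * mu ^ m.-1 * \big[Rplus/0]_(c <- comps m j) prodR (fun i => lpnorm p (x phi i)) c).
Proof.
move=> j1; apply: Rle_trans (K1_ge _) _.
have := Kinv_right_inverse K1K K1invK phi j; rewrite big_allcomps; case: j j1 => [|[|j]] // _.
rewrite big_ltn // comps0S big_nil Monoid.mul1m big_ltn // big_comps1 //.
set T := \big[_/_]_(2 <= m < _) _ => e.
have -> : K1_ (x phi j.+2) = vopp T.
  apply: functional_extensionality => rs; have := congr1 (fun f => f rs) e => ers.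
  have := congr1 Cre ers; have := congr1 Cim ers => /= h1 h2.
  by apply: CC_ext => /=; move: h1 h2; rewrite /K1 /=; lra.
rewrite lpnorm_opp; apply: Rle_trans (lpnorm_sum _ _ hp) _; apply: sum_nat_le => m /andP[m2 _].
by apply: sum_Kop_le; lia.
Qed.

Lemma sum_pow_le (s : R) N : 0 <= s -> mu * s < 1 ->
  \big[Rplus/0]_(2 <= m < N.+2) (mu ^ m.-1 * s ^ m) <= s * (mu * s) * / (1 - mu * s).
Proof.
move=> s0 hs; have u0 : 0 <= mu * s by nra.
rewrite big_add1 big_add1 /=; apply: (@Rle_trans _ (\big[Rplus/0]_(0 <= k < N) (s * (mu * s) * (mu * s) ^ k))).
  by apply: sum_nat_le => k _; rewrite Rpow_mult_distr /=; lra.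
rewrite -big_distrr /=; apply: Rmult_le_compat_l; first by nra.
exact: geom_le.
Qed.

Lemma Rs_bounds : 0 < Rs /\ mu * Rs < 1.
Proof.
have [w [w1 ew eR er]] := constants C_gt0 nu_gt0 mu_gt0.
split; last by apply: (Rmult_lt_reg_r w); lra.
apply: (Rmult_lt_reg_r (mu * w)); first by nra.
by rewrite Rmult_0_l; nra.
Qed.

Lemma r_gt0 : 0 < r.
Proof.
have [w [w1 ew eR er]] := constants C_gt0 nu_gt0 mu_gt0; have := C_gt0 => hC.
apply: (Rmult_lt_reg_r (mu * (w + 1))); first by nra.
rewrite Rmult_0_l; nra.
Qed.

(* [R_star] is the critical point, and [r / C] the critical value, of [s - (nu/C) mu s^2/(1 - mu s)]. *)
Lemma Rs_invariant y s : 0 <= y -> C * y <= r -> 0 <= s <= Rs ->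
  C * y + nu * (s * (mu * s) * / (1 - mu * s)) <= C * Rs.
Proof.
have [w [w1 ew eR er]] := constants C_gt0 nu_gt0 mu_gt0; have [R0 R1] := Rs_bounds.
have hC := C_gt0; move=> y0 hy [s0 hs].
(* Monotonicity leaves only [s = Rs] and [C * y = r], where the claim is an equality. *)
have mono : s * (mu * s) * / (1 - mu * s) <= Rs * (mu * Rs) * / (1 - mu * Rs).
  have h1 : mu * s <= mu * Rs by apply: Rmult_le_compat_l; lra.
  apply: Rmult_le_compat; [by nra | by apply/Rlt_le/Rinv_0_lt_compat; lra | by nra |].
  by apply: Rinv_le_contravar; lra.
have e1 : Rs = (w - 1) / (mu * w) by rewrite -eR; field; lra.
have e2 : r = C * (w - 1) / (mu * (w + 1)) by rewrite -er; field; lra.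
apply: (@Rle_trans _ (r + nu * (Rs * (mu * Rs) * / (1 - mu * Rs)))).
  by apply: Rplus_le_compat => //; apply: Rmult_le_compat_l => //; lra.
apply: Req_le; rewrite e2 e1 -ew.
by field; repeat split; try lra; nra.
Qed.

(** Induction on [N]: all nonlinear contributions up to degree [N + 1] involve the first [N] terms
    only, so their total is controlled by the sum [s] already known to be at most [Rs]. *)
Lemma sum_x_le phi N : lpnorm p phi < r ->
  \big[Rplus/0]_(1 <= i < N.+1) lpnorm p (x phi i) <= Rs.
Proof.
move=> hphi; have [R0 R1] := Rs_bounds; have hC := C_gt0.
set a := fun i => lpnorm p (x phi i).
have a0 i : 0 <= a i by exact: lpnorm_ge0.
elim: N => [|N ih]; first by rewrite big_geq //; lra.
set s := \big[Rplus/0]_(1 <= i < N.+1) a i in ih.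
have s0 : 0 <= s by apply: sum_nat_ge0.
have u1 : mu * s < 1 by nra.
(* Cutting at [N] keeps the base of the powers equal to [s] although degrees run up to [N + 1]. *)
pose a' i := if (i <= N)%N then a i else 0.
have a'0 i : 0 <= a' i by rewrite /a'; case: ifP => _ //; lra.
have sa' : \big[Rplus/0]_(1 <= i < N.+2) a' i = s.
  rewrite big_nat_recr //= {2}/a' ltnn Rplus_0_r; apply: congr_big_nat => // i /and3P[_ _ hi].
  by rewrite /a' -ltnS hi.
rewrite big_ltn //; apply: (Rmult_le_reg_l C) => //; rewrite Rmult_plus_distr_l.
apply: Rle_trans (Rs_invariant (y := a 1%N) (s := s) _ _ _) => //; last 1 first.
- by apply: Rle_trans (x1_le phi) _; lra.
apply: Rplus_le_compat_l.
apply: (@Rle_trans _ (nu * \big[Rplus/0]_(2 <= m < N.+2) (mu ^ m.-1 * s ^ m))); last first.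
  by apply: Rmult_le_compat_l; [lra | exact: sum_pow_le].
rewrite !big_distrr /=.
apply: (@Rle_trans _ (\big[Rplus/0]_(2 <= j < N.+2) \big[Rplus/0]_(2 <= m < N.+2)
   (nu * mu ^ m.-1 * \big[Rplus/0]_(c <- comps m j) prodR a' c))).
  apply: sum_nat_le => j /andP[j1 jN]; apply: Rle_trans (xS_le _ j1) _.
  apply: (@Rle_trans _ (\big[Rplus/0]_(2 <= m < j.+1)
     (nu * mu ^ m.-1 * \big[Rplus/0]_(c <- comps m j) prodR a' c))); last first.
    apply: sum_nat_widen => // m; apply: Rmult_le_pos.
      by apply: Rmult_le_pos; [lra | apply: pow_le; lra].
    by apply: sum_ge0 => c _; exact: prodR_ge0.
  apply: sum_nat_le => m /andP[m1 _]; apply: Req_le; congr (_ * _).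
  rewrite big_seq [RHS]big_seq; apply: eq_bigr => c hc.
  rewrite /prodR big_seq [RHS]big_seq; apply: eq_bigr => t tc.
  by have := comps_mem hc m1 tc; rewrite /a' => tj; rewrite (_ : (t <= N)%N) //; lia.
rewrite exchange_big_nat /=; apply: sum_nat_le => m _.
rewrite -big_distrr -(Rmult_assoc nu) /=; apply: Rmult_le_compat_l.
  by apply: Rmult_le_pos; [lra | apply: pow_le; lra].
rewrite -sa'; apply: Rle_trans (sum_comps_le _ _ a'0).
have wid j : 0 <= \big[Rplus/0]_(c <- comps m j) prodR a' c.
  by apply: sum_ge0 => c _; exact: prodR_ge0.
by rewrite (@big_cat_nat _ _ _ 2 0) //=; have := @sum_nat_ge0 _ 0 2 (fun i _ => wid i); lra.
Qed.

Lemma xZ a phi j : x (vscale a phi) j = vscale (iter j (Cmul a) Cone) (x phi j).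
Proof. exact: (multilinear_nseqZ _ _ _ (Kinv_multilinear K1K K1invK) [::]). Qed.

Lemma invPartialE N phi : invPartial alpha0 GRV GVV GVS K1inv N phi =
  \big[@vadd Vt/@vzero Vt]_(1 <= m < N.+1) x phi m.
Proof. by rewrite /invPartial vsum_big big_map iota1_nat. Qed.

(** * The sum of the inverse series and its tails *)

Variable psi : (Rt * St -> CC) -> (Vt -> CC).
Hypothesis psi_sum : forall phi, lpnorm p phi < r ->
  vconv (fun N => invPartial alpha0 GRV GVV GVS K1inv N phi) (psi phi).
Notation S_ N phi := (\big[@vadd Vt/@vzero Vt]_(1 <= m < (N : nat).+1) x phi m).

Lemma S_conv phi eps : lpnorm p phi < r -> 0 < eps ->
  exists n0, forall n, (n0 <= n)%N -> lpnorm p (vsub (S_ n phi) (psi phi)) < eps.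
Proof.
move=> hphi e0; have [n0 hn] := vconv_lpnorm hp (psi_sum hphi) e0.
by exists n0 => n /hn; rewrite invPartialE.
Qed.

Lemma S_le phi N : lpnorm p phi < r -> lpnorm p (S_ N phi) <= Rs.
Proof. by move=> hphi; apply: Rle_trans (lpnorm_sum _ _ hp) _; exact: sum_x_le. Qed.

Lemma psi_le phi : lpnorm p phi < r -> lpnorm p (psi phi) <= Rs.
Proof.
move=> hphi; apply: le_epsilon => eps e0.
have [n0 /(_ n0 (leqnn _)) hn] := S_conv hphi e0.
have := S_le n0 hphi; have := lpnorm_le_vsub (psi phi) (S_ n0 phi) hp; lra.
Qed.

Lemma psi_tail phi v N B : lpnorm p phi < r ->
  (forall n, (N <= n)%N -> \big[Rplus/0]_(N.+1 <= l < n.+1) Cmod (x phi l v) <= B) ->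
  Cmod (Csub (psi phi v) (S_ N phi v)) <= B.
Proof.
move=> hphi hB; apply: le_epsilon => eps e0.
have [n0 hn] := S_conv hphi e0; pose n := maxn n0 N.
have {}hn := hn n (leq_maxl _ _).
have Nn : (N <= n)%N by exact: leq_maxr.
have e : S_ n phi v = Cadd (S_ N phi v) (\big[Cadd/C0]_(N.+1 <= l < n.+1) x phi l v).
  by rewrite !big_vadd_at -big_cat_nat.
have -> : Csub (psi phi v) (S_ N phi v) = Cadd (Copp (vsub (S_ n phi) (psi phi) v))
    (\big[Cadd/C0]_(N.+1 <= l < n.+1) x phi l v).
  by rewrite /vsub e; cc.
apply: Rle_trans (Cmod_triangle _ _) _; rewrite Cmod_opp.
have := lpnorm_ge_term hp (vsub (S_ n phi) (psi phi)) v.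
have := Cmod_csum (index_iota N.+1 n.+1) (fun l => x phi l v).
by have := hB n Nn; lra.
Qed.

(** Cauchy's estimate for the partial sum of order [N] at [cis t * phi], a polynomial in [cis t]
    bounded by [M + eps]. One [N] serves every [t], since the tail is bounded through norms that do
    not depend on [t]. *)
Lemma x_le_sup M phi m v : (forall phi', lpnorm p phi' < r -> lpnorm p (psi phi') <= M) ->
  lpnorm p phi < r -> (0 < m)%N -> Cmod (x phi m v) <= M.
Proof.
move=> hM hphi m0; apply: le_epsilon => eps e0.
have [n0 hn] := bounded_sum_tail (fun i => lpnorm_ge0 p (x phi i)) (fun n => sum_x_le n hphi) e0.
pose N := maxn n0 m.
apply: (@cauchy_estimate N (fun l => x phi l v)); last by rewrite m0 leq_maxr.
move=> t; pose phi' := vscale (cis t) phi.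
have hphi' : lpnorm p phi' < r by rewrite lpnorm_scale // Cmod_cis Rmult_1_l.
have xE l : x phi' l v = Cmul (cis (INR l * t)) (x phi l v) by rewrite xZ iter_cis.
under eq_bigr do rewrite -xE.
rewrite -(big_vadd_at (index_iota 1 N.+1) (fun l => x phi' l) v).
have -> : S_ N phi' v = Cadd (psi phi' v) (Copp (Csub (psi phi' v) (S_ N phi' v))) by cc.
apply: Rle_trans (Cmod_triangle _ _) _; rewrite Cmod_opp; apply: Rplus_le_compat.
  exact: Rle_trans (lpnorm_ge_term hp _ _) (hM _ hphi').
apply: psi_tail => // n Nn; apply: Rle_trans (hn N n _); last by rewrite leq_maxl.
by apply: sum_nat_le => l _; rewrite xE Cmod_mul Cmod_cis Rmult_1_l; exact: lpnorm_ge_term.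
Qed.

Lemma x_le_geometric M tau phi m v :
  (forall phi', lpnorm p phi' < r -> lpnorm p (psi phi') <= M) ->
  0 < tau < 1 -> (0 < m)%N ->
  Cmod (x phi m v) <= M * (lpnorm p phi / (tau * r)) ^ m.
Proof.
move=> hM htau m0; have hr := r_gt0; have htr : 0 < tau * r by nra.
have h0 := lpnorm_ge0 p phi; set x0 := lpnorm p phi / (tau * r).
have x00 : 0 <= x0 by apply: Rmult_le_pos => //; apply/Rlt_le/Rinv_0_lt_compat.
have zero_lt : lpnorm p (@vzero (Rt * St)) < r by rewrite lpnorm_zero.
case: (Req_dec (lpnorm p phi) 0) => [z|nz].
  have -> : phi = vscale C0 phi.
    by rewrite (lpnorm_eq0 hp z); apply: functional_extensionality => i; cc.
  rewrite xZ; case: m m0 => // m _; rewrite iterS /vscale Cmul0l Cmul0l Cmod0.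
  apply: Rmult_le_pos; last exact: pow_le.
  by apply: Rle_trans (hM _ zero_lt); exact: lpnorm_ge0.
have x0p : 0 < x0 by apply: Rdiv_lt_0_compat; lra.
(* [phi'] has norm exactly [tau * r], inside the ball; degree [m] homogeneity brings back
   [x0 ^ m]. *)
pose phi' := vscale (mkC (/ x0) 0) phi.
have hphi' : lpnorm p phi' < r.
  rewrite lpnorm_scale // Cmod_real Rabs_pos_eq; last by apply/Rlt_le/Rinv_0_lt_compat.
  have -> : / x0 * lpnorm p phi = tau * r by rewrite /x0; field; repeat split; lra.
  nra.
have -> : phi = vscale (mkC x0 0) phi'.
  apply: functional_extensionality => i; rewrite /phi' /vscale.
  by apply: CC_ext => /=; field; lra.
rewrite xZ iter_Cmul_real /vscale Cmod_mul Cmod_real Rabs_pos_eq; last exact: pow_le.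
rewrite Rmult_comm; apply: Rmult_le_compat_r; first exact: pow_le.
exact: x_le_sup.
Qed.

Lemma psi_tail_geometric M tau phi N n :
  (forall phi', lpnorm p phi' < r -> lpnorm p (psi phi') <= M) ->
  0 < tau < 1 -> lpnorm p phi < tau * r ->
  lpnorm PInf (vsub (psi phi) (S_ N phi)) <=
    M * (/ (1 - tau)) ^ n * (lpnorm p phi / (tau * r)) ^ N * / (1 - lpnorm p phi / (tau * r)).
Proof.
move=> hM htau hphi; have hr := r_gt0; have htr : 0 < tau * r by nra.
have h0 := lpnorm_ge0 p phi; set x0 := lpnorm p phi / (tau * r).
have x00 : 0 <= x0 by apply: Rmult_le_pos => //; apply/Rlt_le/Rinv_0_lt_compat.
have x01 : x0 < 1.
  by apply: (Rmult_lt_reg_r (tau * r)) => //; rewrite /x0 /Rdiv Rmult_assoc Rinv_l; lra.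
have hphi' : lpnorm p phi < r by nra.
have M0 : 0 <= M by apply: Rle_trans (hM _ hphi'); exact: lpnorm_ge0.
have ix : 0 < / (1 - x0) by apply: Rinv_0_lt_compat; lra.
have xN := pow_le x0 N x00.
have step : M * x0 ^ N * / (1 - x0) <= M * (/ (1 - tau)) ^ n * x0 ^ N * / (1 - x0).
  apply: Rmult_le_compat_r; first lra; apply: Rmult_le_compat_r => //.
  rewrite -[X in X <= _]Rmult_1_r; apply: Rmult_le_compat_l => //.
  by apply: pow_R1_Rle; rewrite -Rinv_1; apply: Rinv_le_contravar; lra.
apply: Rle_trans step; apply: max_le => [|v]; first by apply: Rmult_le_pos; nra.
rewrite Rabs_pos_eq; last exact: Cmod_ge0.
apply: psi_tail => // n' Nn.
apply: (@Rle_trans _ (\big[Rplus/0]_(0 <= k < (n' - N)%N) (M * x0 ^ N * x0 ^ k))); last first.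
  by rewrite -big_distrr /=; apply: Rmult_le_compat_l; [nra | exact: geom_le].
rewrite -{1}[N.+1]add0n big_addn subSS; apply: sum_nat_le => k _.
apply: Rle_trans (x_le_geometric (tau := tau) phi v hM htau _) _; first by rewrite addnS.
rewrite -/x0 Rmult_assoc; apply: Rmult_le_compat_l => //.
(* The tail starts at degree [N + 1]; one factor [x0 < 1] is given up to reach the exponent [N]. *)
rewrite addnS addnC -pow_add plusE /=.
by have := pow_le x0 (N + k)%N x00; nra.
Qed.

(* Telescoping: [delta m] bounds [(u^m - v^m) / (u - v)] for [u], [v] replaced by the two norms. *)
Fixpoint delta (y z : R) (m : nat) : R := if m is m'.+1 then y * delta y z m' + z ^ m' else 0.

Lemma prod_nseq (y : R) m : \big[Rmult/1]_(e <- nseq m y) e = y ^ m.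
Proof. by elim: m => [|m ih]; rewrite ?big_nil //= big_cons ih. Qed.

(** The slots are changed from [zeta] to [eta] one at a time, each change costing one slot
    [eta - zeta]; the prefix [l] stores the slots already treated. *)
Lemma Kop_diff_le (eta zeta : Vt -> CC) m l :
  lpnorm p (vsub (K (l ++ nseq m eta)) (K (l ++ nseq m zeta))) <=
  nu * mu ^ (size l + m).-1 * \big[Rmult/1]_(e <- l) lpnorm p e
     * delta (lpnorm p eta) (lpnorm p zeta) m * lpnorm p (vsub eta zeta).
Proof.
elim: m l => [|m ih] l.
  rewrite /= Rmult_0_r Rmult_0_l (_ : vsub _ _ = @vzero (Rt * St)); last first.
    by apply: functional_extensionality => i; cc.
  by rewrite lpnorm_zero //; lra.
have lK := Kop_multilinear alpha0 GRV GVV GVS.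
have -> : vsub (K (l ++ nseq m.+1 eta)) (K (l ++ nseq m.+1 zeta)) =
    vadd (vsub (K (rcons l eta ++ nseq m eta)) (K (rcons l eta ++ nseq m zeta)))
         (K (l ++ vsub eta zeta :: nseq m zeta)).
  have -> : vsub eta zeta = vadd (vscale (Copp Cone) zeta) eta.
    by apply: functional_extensionality => i; cc.
  rewrite (lK l _) !cat_rcons /=; apply: functional_extensionality => i; cc.
apply: Rle_trans (lpnorm_triangle hp _ _) _.
apply: Rle_trans (Rplus_le_compat_r _ _ _ (ih _)) _.
set d := lpnorm p (vsub eta zeta); set Pl := \big[Rmult/1]_(e <- l) lpnorm p e.
have -> : (size (rcons l eta) + m).-1 = (size l + m.+1).-1 by rewrite size_rcons addSnnS.
have -> : \big[Rmult/1]_(e <- rcons l eta) lpnorm p e = Pl * lpnorm p eta.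
  by rewrite -cats1 big_cat big_seq1.
have : lpnorm p (K (l ++ vsub eta zeta :: nseq m zeta)) <=
    nu * mu ^ (size l + m.+1).-1 * (Pl * (d * lpnorm p zeta ^ m)).
  have -> : Pl * (d * lpnorm p zeta ^ m) = \big[Rmult/1]_(e <- l ++ vsub eta zeta :: nseq m zeta) lpnorm p e.
    rewrite big_cat big_cons /=; congr (_ * (_ * _)); rewrite -prod_nseq.
    have <- : map (lpnorm p) (nseq m zeta) = nseq m (lpnorm p zeta) by rewrite map_nseq.
    by rewrite big_map.
  have -> : (size l + m.+1)%N = size (l ++ vsub eta zeta :: nseq m zeta).
    by rewrite size_cat /= size_nseq.
  case: (l ++ _) (size_cat l (vsub eta zeta :: nseq m zeta)) => [|e s] sz; last exact: Kop_le.
  by move: sz; rewrite /= addnS.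
move=> h; apply: Rle_trans (Rplus_le_compat_l _ _ _ h) _; apply: Req_le => /=; ring.
Qed.

(** The sums satisfy [s_(N+1) <= u s_N + 1 / (1 - v)], and the bound is the fixed point of this
    recursion. *)
Lemma sum_delta_le u v N : 0 <= u < 1 -> 0 <= v < 1 ->
  \big[Rplus/0]_(1 <= m < N.+1) delta u v m <= / (1 - u) * / (1 - v).
Proof.
move=> hu hv; have iu : 0 < / (1 - u) by apply: Rinv_0_lt_compat; lra.
have iv : 0 < / (1 - v) by apply: Rinv_0_lt_compat; lra.
elim: N => [|N ih]; first by rewrite big_geq //; nra.
rewrite big_add1 /= big_split /= -big_distrr /=.
rewrite big_ltn //= Rplus_0_l.
have := geom_le N.+1 hv.
have -> : / (1 - u) * / (1 - v) = u * (/ (1 - u) * / (1 - v)) + / (1 - v) by field; lra.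
by have := Rmult_le_compat_l u _ _ (proj1 hu) ih; lra.
Qed.

(** Homogeneity absorbs the factor [mu ^ m] of the Born bound into the norms. *)
Lemma delta_scale c y z m : delta (c * y) (c * z) m.+1 = c ^ m * delta y z m.+1.
Proof.
elim: m => [|m ih]; first by rewrite /=; ring.
rewrite [LHS]/= -/(delta (c * y) (c * z) m.+1) ih Rpow_mult_distr /=; ring.
Qed.

(** Parts above [N] contribute zero, and [m] parts up to [N] sum to at most [m * N], so stopping at
    [J] loses nothing. *)
Lemma multilinear_expand (f : seq (Vt -> CC) -> Rt * St -> CC) (y : nat -> Vt -> CC) N m J l :
  multilinear f -> (forall i, (N < i)%N -> y i = @vzero Vt) -> (N + m * N <= J)%N ->
  f (l ++ nseq m (\big[@vadd Vt/@vzero Vt]_(1 <= i < N.+1) y i)) =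
  \big[@vadd _/@vzero _]_(0 <= j < J.+1) \vsum_(c <- comps m j) f (l ++ map y c).
Proof.
move=> lf hy; elim: m J l => [|m ih] J l hJ.
  rewrite [nseq 0 _]/= big_ltn //= big_seq1 big1_seq; last first.
    by move=> [|j]; rewrite ?mem_index_iota //= big_nil.
  by apply: functional_extensionality => i; cc.
under [RHS]eq_bigr do rewrite big_compsS.
rewrite [RHS]big_ltn // (@big_geq _ _ _ 1 1) // Monoid.mul1m.
rewrite -(sum_triangle _ (fun i j => \vsum_(c <- comps m j) f (l ++ map y (i :: c)))).
rewrite [RHS](@big_cat_nat _ _ _ N.+1) //=; last by lia.
rewrite [X in vadd _ X](_ : _ = @vzero (Rt * St)); last first.
  rewrite big_nat big1 // => i /andP[Ni _]; apply: big1 => j _; apply: big1 => c _.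
  by rewrite hy //; exact: (linear0 (lf _ _)).
rewrite (linear_sum (lf l _)) vaddC vadd0; apply: congr_big_nat => // i /and3P[_ i1 iN].
rewrite -cat_rcons (ih (J - i)%N); last by lia.
by apply: eq_bigr => j _; apply: eq_bigr => c _; rewrite cat_rcons.
Qed.

(* Truncating the inverse series at order [N] leaves, in the Born series, only terms of
   degree more than [N] in [phi]; comparing with [phi / tau] these carry a factor [tau^N]. *)
Lemma defect_le tau phi N : 0 < tau < 1 -> lpnorm p phi < tau * r -> (0 < N)%N ->
  lpnorm p (vsub (\big[@vadd _/@vzero _]_(1 <= m < N.+1) K (nseq m (S_ N phi))) phi) <=
  tau ^ N * (nu * (Rs * / (1 - mu * Rs))).
Proof.
move=> htau hphi N0; have [R0 R1] := Rs_bounds; have hr := r_gt0.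
pose y i := if (i <= N)%N then x phi i else @vzero Vt.
have yN i : (N < i)%N -> y i = @vzero Vt by rewrite /y => Ni; rewrite leqNgt Ni.
have Sy : S_ N phi = \big[@vadd Vt/@vzero Vt]_(1 <= i < N.+1) y i.
  by apply: congr_big_nat => // i /and3P[_ _ iN]; rewrite /y -ltnS iN.
pose J := (N + N * N)%N.
pose D := \big[@vadd _/@vzero _]_(1 <= m < N.+1)
   \big[@vadd _/@vzero (Rt * St)]_(N.+1 <= j < J.+1) \vsum_(c <- comps m j) K (map y c).
have e : \big[@vadd _/@vzero _]_(1 <= m < N.+1) K (nseq m (S_ N phi)) = vadd phi D.
  transitivity (vadd (\big[@vadd _/@vzero (Rt * St)]_(1 <= m < N.+1)
     \big[@vadd _/@vzero (Rt * St)]_(0 <= j < N.+1) \vsum_(c <- comps m j) K (map y c)) D).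
    rewrite -big_split /=; apply: congr_big_nat => // m /and3P[_ m1 mN].
    rewrite Sy (multilinear_expand (J := J) [::] (Kop_multilinear _ _ _ _) yN); last first.
      by rewrite leq_add2l leq_mul2r -ltnS mN orbT.
    by rewrite -big_cat_nat //= ltnS leq_addr.
  congr vadd; rewrite exchange_big_nat /=.
  transitivity (\big[@vadd _/@vzero (Rt * St)]_(0 <= j < N.+1) if j == 1%N then phi else @vzero (Rt * St)).
    (* Up to degree [N] no part exceeds [N], so [y] agrees with [x] and the right-inverse identity
       evaluates the whole degree. *)
    apply: congr_big_nat => // j /and3P[_ _ jN].
    rewrite -(Kinv_right_inverse K1K K1invK phi j) (@big_allcomps_widen _ _ N) //.
    rewrite [RHS]big_ltn //.
    have -> : \vsum_(c <- comps 0 j) K (map (fun i => x phi i) c) = @vzero (Rt * St).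
      by case: j {jN} => [|j]; rewrite ?big_seq1 ?big_nil.
    rewrite vadd0; apply: eq_bigr => m _; rewrite big_seq [RHS]big_seq; apply: eq_bigr => c hc.
    congr K; apply/eq_in_map => t tc; have [_ sj _] := comps_spec hc.
    have tj : (t <= j)%N by rewrite -sj; case/splitPr: tc => c1 c2; rewrite sumn_cat /=; lia.
    by rewrite /y (leq_trans tj).
  rewrite big_ltn // big_ltn //= big_nat big1 => [|[|[|i]] //].
  by apply: functional_extensionality => i; cc.
rewrite e (_ : vsub _ _ = D); last by apply: functional_extensionality => i; cc.
(* [phi / tau] still lies in the ball of radius [r], so its terms have total norm at most [Rs];
   homogeneity puts [tau ^ j] on degree [j], and every degree in [D] exceeds [N]. *)
pose phi' := vscale (mkC (/ tau) 0) phi.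
have hphi' : lpnorm p phi' < r.
  rewrite lpnorm_scale // Cmod_real Rabs_pos_eq; last by apply/Rlt_le/Rinv_0_lt_compat; lra.
  apply: (Rmult_lt_reg_l tau); first lra.
  by have -> : tau * (/ tau * lpnorm p phi) = lpnorm p phi by field; lra.
pose a i := if (i <= N)%N then lpnorm p (x phi' i) else 0.
have a0 i : 0 <= a i by rewrite /a; case: ifP => _; [exact: lpnorm_ge0 | lra].
have ya i : lpnorm p (y i) = tau ^ i * a i.
  rewrite /y /a; case: ifP => _; last by rewrite lpnorm_zero //; lra.
  have {1}-> : phi = vscale (mkC tau 0) phi'.
    by apply: functional_extensionality => rs; apply: CC_ext => /=; field; lra.
  rewrite xZ lpnorm_scale // iter_Cmul_real Cmod_real Rabs_pos_eq //.
  by apply: pow_le; lra.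
have sa : \big[Rplus/0]_(1 <= i < J.+1) a i <= Rs.
  rewrite (@big_cat_nat _ _ _ N.+1) //=; last by rewrite ltnS leq_addr.
  rewrite [X in _ + X <= _]big_nat [X in _ + X <= _]big1; last first.
    by move=> i /andP[Ni _]; rewrite /a leqNgt Ni.
  rewrite Rplus_0_r; apply: Rle_trans (sum_x_le N hphi'); apply: sum_nat_le => i /andP[_ iN].
  by rewrite /a -ltnS iN; lra.
have tN := pow_le tau N ltac:(lra).
apply: Rle_trans (lpnorm_sum _ _ hp) _.
apply: (@Rle_trans _ (\big[Rplus/0]_(1 <= m < N.+1) (tau ^ N * (nu * (Rs * (mu * Rs) ^ m.-1))))); last first.
  rewrite -!big_distrr /=; apply: Rmult_le_compat_l => //; apply: Rmult_le_compat_l; first lra.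
  apply: Rmult_le_compat_l; first lra.
  by rewrite big_add1 /=; apply: geom_le; split => //; nra.
apply: sum_nat_le => m /andP[m1 mN]; apply: Rle_trans (lpnorm_sum _ _ hp) _.
apply: (@Rle_trans _ (\big[Rplus/0]_(N.+1 <= j < J.+1)
    (nu * mu ^ m.-1 * tau ^ N * \big[Rplus/0]_(c <- comps m j) prodR a c))).
  apply: sum_nat_le => j /andP[Nj _]; apply: Rle_trans (sum_Kop_le _ _ m1) _.
  rewrite (Rmult_assoc (nu * _)); apply: Rmult_le_compat_l.
    by apply: Rmult_le_pos; [lra | apply: pow_le; lra].
  rewrite big_distrr /=; apply: sum_le => c /comps_spec[_ sj _].
  have -> : prodR (fun i => lpnorm p (y i)) c = tau ^ j * prodR a c.
    rewrite -sj /prodR; elim: c {sj} => [|i c ih]; first by rewrite !big_nil /=; ring.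
    by rewrite !big_cons ih ya /= -plusE pow_add; ring.
  apply: Rmult_le_compat_r; first exact: prodR_ge0.
  have -> : j = (N + (j - N))%coq_nat by lia.
  rewrite pow_add; have : tau ^ (j - N) <= 1.
    by rewrite -(pow1 (j - N)); apply: pow_incr; lra.
  have := pow_le tau (j - N) ltac:(lra); nra.
rewrite -big_distrr /=.
have -> : tau ^ N * (nu * (Rs * (mu * Rs) ^ m.-1)) = nu * mu ^ m.-1 * tau ^ N * Rs ^ m.
  have -> : Rs ^ m = Rs * Rs ^ m.-1 by rewrite -{1}(prednK m1).
  by rewrite Rpow_mult_distr; ring.
apply: Rmult_le_compat_l.
  by apply: Rmult_le_pos => //; apply: Rmult_le_pos; [lra | apply: pow_le; lra].
apply: (@Rle_trans _ ((\big[Rplus/0]_(1 <= i < J.+1) a i) ^ m)); last first.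
  by apply: pow_incr; split => //; apply: sum_nat_ge0.
apply: Rle_trans (sum_comps_le _ _ a0).
have wid j : 0 <= \big[Rplus/0]_(c <- comps m j) prodR a c.
  by apply: sum_ge0 => c _; exact: prodR_ge0.
rewrite [X in _ <= X](@big_cat_nat _ _ _ N.+1) //=; last by rewrite ltnS leq_addr.
by have := @sum_nat_ge0 _ 0 N.+1 (fun i _ => wid i); lra.
Qed.

Lemma scatPartialE N eta : scatPartial alpha0 GRV GVV GVS N eta =
  \big[@vadd _/@vzero _]_(1 <= m < N.+1) K (nseq m eta).
Proof. by rewrite /scatPartial vsum_big big_map iota1_nat. Qed.

(* With [u], [v] the norms of [eta], [zeta] times [mu], the nonlinear part is Lipschitz with
   constant [nu (1 / ((1 - u) (1 - v)) - 1) < nu (w^2 - 1) = C]. *)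
Lemma born_expansive eta : lpnorm p eta < Rs -> exists2 k, 0 < k &
  forall zeta N, lpnorm p zeta <= Rs -> (0 < N)%N ->
    k * lpnorm p (vsub eta zeta) <= lpnorm p (vsub (\big[@vadd _/@vzero _]_(1 <= m < N.+1) K (nseq m eta))
      (\big[@vadd _/@vzero _]_(1 <= m < N.+1) K (nseq m zeta))).
Proof.
move=> heta; have [w [w1 ew eR _]] := constants C_gt0 nu_gt0 mu_gt0; have [R0 R1] := Rs_bounds.
have h0 := lpnorm_ge0 p eta; set u := mu * lpnorm p eta.
have hu : 0 <= u < mu * Rs by rewrite /u; split; [nra | apply: Rmult_lt_compat_l].
have muRs : 1 - mu * Rs = / w by apply: (Rmult_eq_reg_r w); rewrite ?Rinv_l; lra.
have iu : / (1 - u) < w.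
  have iw : 0 < / w by apply: Rinv_0_lt_compat; lra.
  by rewrite -[w]Rinv_inv; apply: Rinv_lt_contravar; [nra | lra].
have iu0 : 0 < / (1 - u) by apply: Rinv_0_lt_compat; lra.
(* [zeta] enters only through [/ (1 - v) <= w], so [k] depends on [eta] alone and serves all
   truncation orders. *)
exists (C - nu * (/ (1 - u) * w - 1)) => [|zeta N hz N0].
  by rewrite -ew -Rmult_minus_distr_l; apply: Rmult_lt_0_compat => //; nra.
have z0 := lpnorm_ge0 p zeta; set d := lpnorm p (vsub eta zeta).
have d0 : 0 <= d by exact: lpnorm_ge0.
set F := fun m => vsub (K (nseq m eta)) (K (nseq m zeta)).
have -> : vsub (\big[@vadd _/@vzero _]_(1 <= m < N.+1) K (nseq m eta))
      (\big[@vadd _/@vzero _]_(1 <= m < N.+1) K (nseq m zeta)) =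
    vadd (K1_ (vsub eta zeta)) (\big[@vadd _/@vzero _]_(2 <= m < N.+1) F m).
  have e1 : K1_ (vsub eta zeta) = F 1%N.
    have -> : vsub eta zeta = vadd (vscale (Copp Cone) zeta) eta.
      by apply: functional_extensionality => i; cc.
    by rewrite K1_linear; apply: functional_extensionality => i; rewrite /F /K1; cc.
  rewrite e1 -big_ltn //.
  have -> : \big[@vadd _/@vzero _]_(1 <= m < N.+1) F m =
      vadd (\big[@vadd _/@vzero _]_(1 <= m < N.+1) K (nseq m eta))
           (\big[@vadd _/@vzero _]_(1 <= m < N.+1) vopp (K (nseq m zeta))).
    by rewrite -big_split.
  have lo : linear (@vopp (Rt * St)) by move=> b f g; apply: functional_extensionality => v; cc.
  by rewrite -(linear_sum lo).
set H := \big[_/_]_(2 <= m < _) _.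
have hH : lpnorm p H <= nu * (/ (1 - u) * w - 1) * d.
  apply: Rle_trans (lpnorm_sum _ _ hp) _.
  set v := mu * lpnorm p zeta.
  have hv : 0 <= v <= mu * Rs by rewrite /v; split; [nra | apply: Rmult_le_compat_l; lra].
  apply: (@Rle_trans _ (\big[Rplus/0]_(2 <= m < N.+1) (nu * d * delta u v m))).
    apply: sum_nat_le => -[|m] // /andP[m2 _].
    apply: Rle_trans (Kop_diff_le eta zeta m.+1 [::]) _.
    by rewrite big_nil delta_scale add0n -pred_Sn -/d; apply: Req_le; ring.
  rewrite -big_distrr /=.
  (* The term [delta u v 1 = 1] belongs to the linear part [K_1]; removing it gives the [- 1] in the
     constant. *)
  have := @sum_delta_le u v N ltac:(lra) ltac:(lra); rewrite big_ltn // [delta u v 1]/= => hs.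
  have iv : / (1 - v) <= w.
    have iw : 0 < / w by apply: Rinv_0_lt_compat; lra.
    by rewrite -[w]Rinv_inv; apply: Rinv_le_contravar; lra.
  have iuv : / (1 - u) * / (1 - v) <= / (1 - u) * w by apply: Rmult_le_compat_l; lra.
  rewrite (_ : nu * (_ - 1) * d = nu * d * (/ (1 - u) * w - 1)); last by ring.
  by apply: Rmult_le_compat_l; [apply: Rmult_le_pos; lra | lra].
have := K1_ge (vsub eta zeta); rewrite -/d => hK.
have := lpnorm_triangle hp (vadd (K1_ (vsub eta zeta)) H) (vopp H); rewrite lpnorm_opp.
rewrite (_ : vadd (vadd _ H) (vopp H) = K1_ (vsub eta zeta)); last first.
  by apply: functional_extensionality => i; apply: CC_ext; rewrite /vadd /vopp /=; ring.
by lra.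
Qed.

(** The truncated Born sums at [eta] and at the partial sum [S_N] both approach [phi], and
    [born_expansive] carries this back to their arguments. Both series are cut at the same [N], so
    the Born series at [S_N] is never summed. *)
Lemma born_inversion tau phi eta : 0 < tau < 1 -> lpnorm p phi < tau * r -> lpnorm p eta < Rs ->
  vconv (fun n => scatPartial alpha0 GRV GVV GVS n eta) phi -> eta = psi phi.
Proof.
move=> htau hphi heta hscat; have hr := r_gt0; have [R0 R1] := Rs_bounds.
have hphi' : lpnorm p phi < r by nra.
have [k k0 hk] := born_expansive heta.
suff : lpnorm p (vsub eta (psi phi)) = 0.
  move=> /(lpnorm_eq0 hp) z; apply: functional_extensionality => i.
  have := congr1 (fun f => f i) z; rewrite /vsub /vzero => zi.
  have := congr1 Cre zi; have := congr1 Cim zi => /= h1 h2.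
  by apply: CC_ext; lra.
apply: Rle_antisym; last exact: lpnorm_ge0.
apply: le_epsilon => eps e0.
set c := nu * (Rs * / (1 - mu * Rs)).
have c0 : 0 < c.
  have : 0 < / (1 - mu * Rs) by apply: Rinv_0_lt_compat; lra.
  by move=> h; apply: Rmult_lt_0_compat => //; exact: Rmult_lt_0_compat.
have ke : 0 < k * eps / 4 by apply: Rmult_lt_0_compat; nra.
have [n1 h1] := S_conv hphi' (ltac:(lra) : 0 < eps / 4).
have [n2 h2] := vconv_lpnorm hp hscat ke.
have [n3 h3] : exists n3, forall n, (n3 <= n)%N -> tau ^ n * c < k * eps / 4.
  have [n3 h] := pow_lt_1_zero tau ltac:(rewrite Rabs_pos_eq; lra) (k * eps / 4 / c)
    ltac:(exact: Rdiv_lt_0_compat).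
  exists n3 => n /leP /h; rewrite Rabs_pos_eq; last by apply: pow_le; lra.
  move=> /(Rmult_lt_compat_r c _ _ c0).
  by have -> : k * eps / 4 / c * c = k * eps / 4 by field; lra.
pose N := (n1 + n2 + n3).+1.
have g1 := h1 N ltac:(rewrite /N; lia); have g2 := h2 N ltac:(rewrite /N; lia).
have g3 := h3 N ltac:(rewrite /N; lia).
have g4 := defect_le (N := N) htau hphi isT; rewrite -/c in g4.
have g5 := hk _ N (S_le N hphi') isT.
rewrite scatPartialE in g2.
set SN := S_ N phi in g1 g4 g5.
have g6 : lpnorm p (vsub eta (psi phi)) <= lpnorm p (vsub eta SN) + lpnorm p (vsub SN (psi phi)).
  apply: Rle_trans (lpnorm_triangle hp _ _).
  by apply: Req_le; congr (lpnorm p _); apply: functional_extensionality => i; apply: CC_ext => /=; ring.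
have g7 : k * lpnorm p (vsub eta SN) <= k * (eps / 2).
  apply: Rle_trans g5 _.
  set A := \big[_/_]_(1 <= m < _) K (nseq m eta) in g2 *.
  set B := \big[_/_]_(1 <= m < _) _ in g4 *.
  have -> : vsub A B = vadd (vsub A phi) (vopp (vsub B phi)).
    by apply: functional_extensionality => i; apply: CC_ext => /=; ring.
  apply: Rle_trans (lpnorm_triangle hp _ _) _; rewrite lpnorm_opp.
  apply: Rle_trans (Rplus_le_compat _ _ _ _ (Rlt_le _ _ g2) g4) _; lra.
by have := Rmult_le_reg_l _ _ _ k0 g7; lra.
Qed.

End InverseBornSeries.

Theorem mainTheorem7 (Vt Rt St : finType) (p q : ext) (alpha0 : R)
  (GRV : Rt -> Vt -> CC) (GVV : Vt -> Vt -> CC) (GVS : Vt -> St -> CC)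
  (K1inv : (Rt * St -> CC) -> (Vt -> CC)) (Cp : R) (psi : (Rt * St -> CC) -> (Vt -> CC)) :
  conjugate p q ->
  0 < alpha0 ->
  (0 < #|Rt|)%N -> (0 < #|St|)%N ->
  #|Vt| = (#|Rt| * #|St|)%N ->
  (* K_1 invertible, with inverse K1inv = \mathcal K_1 *)
  (forall eta, K1inv (K1 alpha0 GRV GVV GVS eta) = eta) ->
  (forall phi, K1 alpha0 GRV GVV GVS (K1inv phi) = phi) ->
  0 < nu_p alpha0 GRV GVS p q ->
  0 < mu_p alpha0 GVV q ->
  (* Cp = min_{||eta||_p = 1} ||K_1 eta||_p *)
  (exists eta, lpnorm p eta = 1 /\ lpnorm p (K1 alpha0 GRV GVV GVS eta) = Cp) ->
  (forall eta, lpnorm p eta = 1 -> Cp <= lpnorm p (K1 alpha0 GRV GVV GVS eta)) ->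
  (* psi(phi) = sum of the inverse Born series for ||phi||_p < r_p *)
  (forall phi, lpnorm p phi < r_p Cp (nu_p alpha0 GRV GVS p q) (mu_p alpha0 GVV q) ->
     vconv (fun N => invPartial alpha0 GRV GVV GVS K1inv N phi) (psi phi)) ->
  let rp := r_p Cp (nu_p alpha0 GRV GVS p q) (mu_p alpha0 GVV q) in
  let Rs := R_star Cp (nu_p alpha0 GRV GVS p q) (mu_p alpha0 GVV q) in
  exists M : R,
    is_lub (fun x => exists phi, lpnorm p phi < rp /\ x = lpnorm p (psi phi)) M /\
    forall (tau : R) (phi : Rt * St -> CC) (N : nat),
      0 < tau < 1 -> lpnorm p phi < tau * rp -> (1 <= N)%N ->
      let bound := M * (/ (1 - tau)) ^ #|Vt| * (lpnorm p phi / (tau * rp)) ^ N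
                     * / (1 - lpnorm p phi / (tau * rp)) in
      lpnorm PInf (vsub (psi phi) (invPartial alpha0 GRV GVV GVS K1inv N phi)) <= bound /\
      (forall eta : Vt -> CC, lpnorm p eta < Rs ->
         vconv (fun n => scatPartial alpha0 GRV GVV GVS n eta) phi ->
         lpnorm PInf (vsub eta (invPartial alpha0 GRV GVV GVS K1inv N phi)) <= bound).
Proof.
move=> pq a0 _ _ _ K1K K1invK nu0 mu0 Catt Cmin psi_sum rp Rs.
have hp := proj1 (conjugate_ge1 pq).
have psiR := psi_le pq a0 K1K K1invK nu0 mu0 Catt Cmin psi_sum.
have [M hM] : {M | is_lub (fun x => exists phi, lpnorm p phi < rp /\ x = lpnorm p (psi phi)) M}.
  apply: completeness; first by exists Rs => y [phi [hphi ->]]; exact: psiR.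
  exists (lpnorm p (psi (@vzero (Rt * St)))), (@vzero (Rt * St)); split => //.
  by rewrite lpnorm_zero //; exact: (r_gt0 pq K1K K1invK nu0 mu0 Catt).
have psiM phi : lpnorm p phi < rp -> lpnorm p (psi phi) <= M.
  by move=> hphi; apply: (proj1 hM); exists phi.
exists M; split => // tau phi N htau hphi _; rewrite /=.
have bnd := psi_tail_geometric pq a0 K1K K1invK nu0 mu0 Catt Cmin psi_sum N #|Vt| psiM htau hphi.
rewrite invPartialE; split => // eta heta hscat.
by rewrite (born_inversion pq a0 K1K K1invK nu0 mu0 Catt Cmin psi_sum htau hphi heta hscat).
Qed.
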